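(* Let $\mathbb{H}=(M,H)$, $M=M_1\times M_2$, $H=H_1+fH_2$, be the warped product Hamiltonian space of Hamiltonian spaces $(M_1,H_1)$ and $(M_2,H_2)$ with nonconstant smooth warping function $f:M_1\to\mathbb{R}^+$. Then the warped Sasaki metric $G$ is bundle-like for the vertical foliation $VT^*M$ if and only if $(M_1,(g_{ij}))$ and $(M_2,(g_{\alpha\beta}))$ are two pseudo-Riemannian manifolds.
   Context: A Hamiltonian space is a pair $(N,K)$ where $N$ is a real finite-dimensional smooth manifold and $K:T^*N\to\mathbb{R}$ is a smooth function whose Hessian with respect to the fibre (momentum) coordinates of $T^*N$ is nondegenerate and of constant signature on $T^*N\setminus\{0\}$. Let $\dim M_1=n$, $\dim M_2=m$. Identify $T^*M=T^*M_1\oplus T^*M_2$ (as a manifold $T^*M_1\times T^*M_2$), with local coordinates $(x^i,p_i)$, $i=1,\dots,n$, on $T^*M_1$ and $(z^\alpha,q_\alpha)$, $\alpha=1,\dots,m$, on $T^*M_2$. Functions on the factors are regarded as functions on $T^*M$ via projection, so $H(x,z,p,q)=H_1(x,p)+f(x)H_2(z,q)$. Write $(\mathbf{x}^a)=(x^i,z^\alpha)$, $(\mathbf{p}_a)=(p_i,q_\alpha)$, $a=1,\dots,n+m$, and $\bar\partial^a=\partial/\partial\mathbf{p}_a$. Repeated indices are summed. Fundamental tensors: $g^{ij}=\frac12\frac{\partial^2H_1}{\partial p_i\partial p_j}$, $g^{\alpha\beta}=\frac12\frac{\partial^2H_2}{\partial q_\alpha\partial q_\beta}$, with inverse matrices $(g_{ij})$,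 $(g_{\alpha\beta})$; and $g^{ab}=\frac12\bar\partial^a\bar\partial^bH$, which is block diagonal with blocks $g^{ij}$ and $f g^{\alpha\beta}$, with inverse $(g_{ab})$ having blocks $g_{ij}$ and $\frac1f g_{\alpha\beta}$. Everything below is considered on the open subset $(T^*M_1\setminus\{0\})\times(T^*M_2\setminus\{0\})$ of $T^*M$, on which these tensors are nondegenerate. ''$(M_1,(g_{ij}))$ is a pseudo-Riemannian manifold'' means that $g_{ij}$ does not depend on the momenta $p$ (so that $(g_{ij}(x))$ is a pseudo-Riemannian metric on $M_1$); similarly $(M_2,(g_{\alpha\beta}))$ is pseudo-Riemannian if $g_{\alpha\beta}$ does not depend on $q$. Poisson bracket: $\{g,h\}=\bar\partial^ag\,\frac{\partial h}{\partial\mathbf{x}^a}-\bar\partial^ah\,\frac{\partial g}{\partial\mathbf{x}^a}$. Canonical nonlinear connection of $(M,H)$: $$\bar N_{ab}=\tfrac14\{g_{ab},H\}-\tfrac14\Big(g_{ac}\frac{\partial^2H}{\partial\mathbf{p}_c\partial\mathbf{x}^b}+g_{bc}\frac{\partial^2H}{\partial\mathbf{p}_c\partial\mathbf{x}^a}\Big).$$ The horizontal distribution $HT^*M$ is spanned locally by $\frac{\delta^*}{\delta^*\mathbf{x}^a}=\frac{\partial}{\partial\mathbf{x}^a}+\bar N_{ab}\bar\partial^b$. The vertical distribution $VT^*M$ is the kernel of the differential of the projection $T^*M\to M$, spanned locally by the $\bar\partial^a$; it is integrable and defines the vertical foliation. With $\delta\mathbf{p}_a=d\mathbf{p}_a-\bar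 N_{ab}d\mathbf{x}^b$, the warped Sasaki metric is the pseudo-Riemannian metric $$G=g_{ab}\,d\mathbf{x}^a\otimes d\mathbf{x}^b+g^{ab}\,\delta\mathbf{p}_a\otimes\delta\mathbf{p}_b .$$ Let $\nabla$ be the Levi-Civita connection of $G$. $G$ is called bundle-like for $VT^*M$ if $G(\nabla_XY+\nabla_YX,Z)=0$ for all $X,Y\in\Gamma(HT^*M)$ and $Z\in\Gamma(VT^*M)$. *)

(* Defs.v *)
From HB Require Import structures.
From mathcomp Require Import all_boot all_order all_algebra.
From mathcomp Require Import all_classical all_reals all_analysis.

Set Implicit Arguments.
Unset Strict Implicit.
Unset Printing Implicit Defensive.

Import Order.TTheory GRing.Theory Num.Theory.
Import numFieldNormedType.Exports.

Local Open Scope classical_set_scope.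
Local Open Scope ring_scope.

(* C^oo on an open set A of R^d: every iterated partial derivative of F
   (in any order, including F itself) is Frechet differentiable on A. *)
Definition smooth_on (R : realType) (d : nat) (W : normedModType R)
    (A : set 'rV[R]_d) (F : 'rV[R]_d -> W) : Prop :=
  forall (s : seq 'I_d) (x : 'rV[R]_d), A x ->
    differentiable (foldr (fun i g => 'D_(delta_mx 0 i) g) F s) x.

(* [inv c] is only meaningful on the image of the chart c. [chart_at] selects a
   chart around each point; it is used to coordinatize tangent and cotangent
   spaces (see [tcomp] and [cotangent]). *)
Record atlas (R : realType) (d : nat) (T : Type) := Atlas {
  idx : Type;
  chart_at : T -> idx;
  dom : idx -> set T;
  crd : idx -> T -> 'rV[R]_d;
  inv : idx -> 'rV[R]_d -> T
}.

Section Manifolds.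
Context {R : realType} {d : nat}.

Definition chart_img {T : Type} (A : atlas R d T) (c : idx A) (U : set T) :
  set 'rV[R]_d := crd c @` (dom c `&` U).

Record smooth_manifold (T : topologicalType) (A : atlas R d T) : Prop := {
  manifold_nonempty : [set: T] !=set0;
  manifold_hausdorff : hausdorff_space T;
  manifold_second_countable : @second_countable T;
  manifold_cover : forall x : T, dom (chart_at A x) x;
  manifold_dom_open : forall c : idx A, open (dom c);
  manifold_img_open : forall c : idx A, open (chart_img c setT);
  manifold_crdK : forall (c : idx A) x, dom c x -> inv c (crd c x) = x;
  manifold_crd_cont : forall (c : idx A) x, dom c x ->
    {for x, continuous (crd c)};
  manifold_inv_cont : forall (c : idx A) y, chart_img c setT y ->
    {for y, continuous (@inv _ _ _ A c)};
  manifold_transition : forall c c' : idx A,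
    smooth_on (chart_img c (dom c')) (crd c' \o @inv _ _ _ A c)
}.

Definition smooth_fun {T : Type} (A : atlas R d T) (U : set T) (phi : T -> R) :
  Prop := forall c : idx A, smooth_on (chart_img c U) (phi \o @inv _ _ _ A c).

(* Jacobian, at u, of the change from the chart selected at u to the chart c;
   [jacobian] acts on row vectors from the right. *)
Definition change_mx {T : Type} (A : atlas R d T) (c : idx A) (u : T) :
    'M[R]_d :=
  jacobian (crd c \o @inv _ _ _ A (chart_at A u)) (crd (chart_at A u) u).

(* The tangent space at u is R^d, a vector being given by its components in
   the chart selected at u; [tcomp c u v] are its components in the chart c. *)
Definition tcomp {T : Type} (A : atlas R d T) (c : idx A) (u : T)
  (v : 'rV[R]_d) : 'rV[R]_d := v *m change_mx c u.

(* A vector field X on U assigns to u in U the tangent vector X u at u; its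
   values outside U are irrelevant. *)
Definition vcomp {T : Type} (A : atlas R d T) (X : T -> 'rV[R]_d) (c : idx A) :
  'rV[R]_d -> 'rV[R]_d := fun w => tcomp c (inv c w) (X (inv c w)).

Definition smooth_vfield {T : Type} (A : atlas R d T) (U : set T)
    (X : T -> 'rV[R]_d) : Prop :=
  forall c : idx A, smooth_on (chart_img c U) (vcomp X c).

(* X phi *)
Definition vderive {T : Type} (A : atlas R d T) (X : T -> 'rV[R]_d)
    (phi : T -> R) : T -> R := fun u =>
  'd (phi \o @inv _ _ _ A (chart_at A u)) (crd (chart_at A u) u) (X u).

(* [X, Y] = X^A d_A Y - Y^A d_A X *)
Definition lie_bracket {T : Type} (A : atlas R d T) (X Y : T -> 'rV[R]_d) :
    T -> 'rV[R]_d := fun u =>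
  'd (@vcomp _ A Y (chart_at A u)) (crd (chart_at A u) u) (X u)
  - 'd (@vcomp _ A X (chart_at A u)) (crd (chart_at A u) u) (Y u).

Definition affine_connection {T : Type} (A : atlas R d T) (U : set T)
    (nabla : (T -> 'rV[R]_d) -> (T -> 'rV[R]_d) -> T -> 'rV[R]_d) : Prop :=
  [/\ forall X Y, smooth_vfield A U X -> smooth_vfield A U Y ->
        smooth_vfield A U (nabla X Y),
      forall X X' Y, smooth_vfield A U X -> smooth_vfield A U X' ->
        smooth_vfield A U Y ->
        {in U, forall u,
          nabla (fun v => X v + X' v) Y u = nabla X Y u + nabla X' Y u},
      forall phi X Y, smooth_fun A U phi -> smooth_vfield A U X ->
        smooth_vfield A U Y ->
        {in U, forall u, nabla (fun v => phi v *: X v) Y u = phi u *: nabla X Y u},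
      forall X Y Y', smooth_vfield A U X -> smooth_vfield A U Y ->
        smooth_vfield A U Y' ->
        {in U, forall u,
          nabla X (fun v => Y v + Y' v) u = nabla X Y u + nabla X Y' u}
    & forall phi X Y, smooth_fun A U phi -> smooth_vfield A U X ->
        smooth_vfield A U Y ->
        {in U, forall u, nabla X (fun v => phi v *: Y v) u
          = vderive A X phi u *: Y u + phi u *: nabla X Y u}].

Definition levi_civita {T : Type} (A : atlas R d T) (U : set T)
    (G : T -> 'rV[R]_d -> 'rV[R]_d -> R)
    (nabla : (T -> 'rV[R]_d) -> (T -> 'rV[R]_d) -> T -> 'rV[R]_d) : Prop :=
  [/\ affine_connection A U nabla,
      forall X Y, smooth_vfield A U X -> smooth_vfield A U Y ->
        {in U, forall u, nabla X Y u - nabla Y X u = lie_bracket A X Y u}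
    & forall X Y Z, smooth_vfield A U X -> smooth_vfield A U Y ->
        smooth_vfield A U Z ->
        {in U, forall u, vderive A X (fun v => G v (Y v) (Z v)) u
          = G u (nabla X Y u) (Z u) + G u (Y u) (nabla X Z u)}].

End Manifolds.

Definition prod_atlas (R : realType) (n m : nat) (T1 T2 : Type)
    (A1 : atlas R n T1) (A2 : atlas R m T2) : atlas R (n + m) (T1 * T2) := {|
  idx := idx A1 * idx A2;
  chart_at := fun x => (chart_at A1 x.1, chart_at A2 x.2);
  dom := fun c => dom c.1 `*` dom c.2;
  crd := fun c x => row_mx (crd c.1 x.1) (crd c.2 x.2);
  inv := fun c y => (inv c.1 (lsubmx y), inv c.2 (rsubmx y))
|}.

(* T^*N: a covector at x is given by its components in the chart selected at x;
   covector components transform by p_a = p'_b dx'^b/dx^a. The canonical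
   coordinates of (x, p) in the chart c are row_mx (coordinates) (momenta). *)
Definition cotangent (R : realType) (n : nat) (T : Type) (A : atlas R n T) :
    atlas R (n + n) (T * 'rV[R]_n) := {|
  idx := idx A;
  chart_at := fun u => chart_at A u.1;
  dom := fun c => [set u | dom c u.1];
  crd := fun c u => row_mx (crd c u.1)
    (u.2 *m (jacobian (crd (chart_at A u.1) \o @inv _ _ _ A c) (crd c u.1))^T);
  inv := fun c w => (inv c (lsubmx w), rsubmx w *m (change_mx c (inv c (lsubmx w)))^T)
|}.

(* Local formulas in canonical coordinates w = (x, p) of a cotangent bundle,
   for the coordinate expression K of the Hamiltonian. *)
Section LocalHamilton.
Context {R : realType} {n : nat}.
Implicit Types (F K : 'rV[R]_(n + n) -> R) (w v : 'rV[R]_(n + n)).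

Definition dx (a : 'I_n) F : 'rV[R]_(n + n) -> R :=
  'D_(delta_mx 0 (lshift n a)) F.

Definition dp (a : 'I_n) F : 'rV[R]_(n + n) -> R :=
  'D_(delta_mx 0 (rshift n a)) F.

Definition fibre_hessian K w : 'M[R]_n := \matrix_(a, b) dp a (dp b K) w.

(* g^{ab} *)
Definition gup K w : 'M[R]_n := 2^-1 *: fibre_hessian K w.

(* g_{ab} *)
Definition glow K w : 'M[R]_n := invmx (gup K w).

Definition poisson F K w : R :=
  \sum_(a < n) (dp a F w * dx a K w - dp a K w * dx a F w).

Definition nonlinear_connection K w : 'M[R]_n := \matrix_(a, b)
  (4^-1 * poisson (fun w' => glow K w' a b) K w
   - 4^-1 * \sum_(c < n) (glow K w a c * dp c (dx b K) w
                          + glow K w b c * dp c (dx a K) w)).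

(* Row a is the vector field delta^*/delta^* x^a. *)
Definition delta_star K w : 'M[R]_(n, n + n) :=
  row_mx 1%:M (nonlinear_connection K w).

(* Components of the 1-forms delta p_a on v. *)
Definition delta_p K w v : 'rV[R]_n :=
  rsubmx v - lsubmx v *m (nonlinear_connection K w)^T.

Definition local_sasaki K w v v' : R :=
  \sum_(a < n) \sum_(b < n) glow K w a b * lsubmx v 0 a * lsubmx v' 0 b
  + \sum_(a < n) \sum_(b < n)
      gup K w a b * delta_p K w v 0 a * delta_p K w v' 0 b.

End LocalHamilton.

(* A is congruent to the diagonal matrix with r entries 1 followed by
   n - r entries -1. *)
Definition has_signature (R : realType) (n : nat) (A : 'M[R]_n) (r : nat) :
    Prop :=
  (r <= n)%N /\ exists2 P : 'M[R]_n, P \in unitmx &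
    P *m A *m P^T = diag_mx (\row_(i < n) (if (i < r)%N then 1 else -1)).

Section Hamilton.
Context {R : realType} {n : nat} {T : Type} (A : atlas R n T).
Implicit Types (K : T * 'rV[R]_n -> R) (U : set (T * 'rV[R]_n)).

(* Coordinate expression in the canonical chart c. *)
Definition lexpr K (c : idx A) : 'rV[R]_(n + n) -> R :=
  K \o @inv _ _ _ (cotangent A) c.

Definition hamiltonian_space K : Prop :=
  [/\ smooth_fun (cotangent A) setT K,
      forall (c : idx A) w, chart_img (A := cotangent A) c [set u | u.2 != 0] w ->
        fibre_hessian (lexpr K c) w \in unitmx
    & exists r : nat, forall (c : idx A) w,
        chart_img (A := cotangent A) c [set u | u.2 != 0] w ->
        has_signature (fibre_hessian (lexpr K c) w) r].

(* g_{ij} does not depend on the momenta on T^*N minus the zero section. *)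
Definition pseudo_riemannian K : Prop :=
  forall (c : idx A) (x p p' : 'rV[R]_n), chart_img c setT x ->
    p != 0 -> p' != 0 ->
    glow (lexpr K c) (row_mx x p) = glow (lexpr K c) (row_mx x p').

(* G is the tensor field on U given in every canonical chart by
   g_ab dx^a (x) dx^b + g^ab delta p_a (x) delta p_b. *)
Definition sasaki_metric K U
    (G : T * 'rV[R]_n -> 'rV[R]_(n + n) -> 'rV[R]_(n + n) -> R) : Prop :=
  forall (c : idx A) u v v', dom (a := cotangent A) c u -> U u ->
    G u v v' = local_sasaki (lexpr K c) (crd (a := cotangent A) c u)
      (tcomp (A := cotangent A) c u v) (tcomp (A := cotangent A) c u v').

(* Smooth sections over U of the horizontal distribution. *)
Definition horizontal K U (X : T * 'rV[R]_n -> 'rV[R]_(n + n)) : Prop :=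
  smooth_vfield (cotangent A) U X /\
  forall (c : idx A) u, dom (a := cotangent A) c u -> U u ->
    (tcomp (A := cotangent A) c u (X u)
       <= delta_star (lexpr K c) (crd (a := cotangent A) c u))%MS.

(* Smooth sections over U of the vertical distribution: in canonical
   coordinates the bundle projection is [lsubmx]. *)
Definition vertical U (X : T * 'rV[R]_n -> 'rV[R]_(n + n)) : Prop :=
  smooth_vfield (cotangent A) U X /\
  forall (c : idx A) u, dom (a := cotangent A) c u -> U u ->
    'd (@lsubmx R 1 n n) (crd (a := cotangent A) c u)
       (tcomp (A := cotangent A) c u (X u)) = 0.

Definition bundle_like K U
    (G : T * 'rV[R]_n -> 'rV[R]_(n + n) -> 'rV[R]_(n + n) -> R)
    (nabla : (T * 'rV[R]_n -> 'rV[R]_(n + n)) ->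
             (T * 'rV[R]_n -> 'rV[R]_(n + n)) ->
             T * 'rV[R]_n -> 'rV[R]_(n + n)) : Prop :=
  forall X Y Z, horizontal K U X -> horizontal K U Y -> vertical U Z ->
    {in U, forall u, G u (nabla X Y u + nabla Y X u) (Z u) = 0}.

End Hamilton.

Section Warped.
Context {R : realType} {n m : nat} {T1 T2 : Type}.

(* Restrictions to the factors of a covector of T1 * T2; the charts selected by
   [prod_atlas] are products, so momenta just split. *)
Definition cot_fst (u : (T1 * T2) * 'rV[R]_(n + m)) : T1 * 'rV[R]_n :=
  (u.1.1, lsubmx u.2).

Definition cot_snd (u : (T1 * T2) * 'rV[R]_(n + m)) : T2 * 'rV[R]_m :=
  (u.1.2, rsubmx u.2).

Definition warped_hamiltonian (H1 : T1 * 'rV[R]_n -> R)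
    (H2 : T2 * 'rV[R]_m -> R) (f : T1 -> R) :
    (T1 * T2) * 'rV[R]_(n + m) -> R :=
  fun u => H1 (cot_fst u) + f u.1.1 * H2 (cot_snd u).

(* (T^*M1 minus 0) x (T^*M2 minus 0) *)
Definition slit_cotangent : set ((T1 * T2) * 'rV[R]_(n + m)) :=
  [set u | (cot_fst u).2 != 0 /\ (cot_snd u).2 != 0].

End Warped.

(* Main.v *)
From HB Require Import structures.
Require Import Defs.
From mathcomp Require Import all_boot all_order all_algebra.
From mathcomp Require Import all_classical all_reals all_analysis.
From mathcomp Require Import ring.
Import Defs.

Set Implicit Arguments.
Unset Strict Implicit.
Unset Printing Implicit Defensive.

Import Order.TTheory GRing.Theory Num.Theory.
Import numFieldNormedType.Exports.
Local Open Scope classical_set_scope.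
Local Open Scope ring_scope.

(** For horizontal X, Y and vertical Z, Koszul's formula and the orthogonality of the
    two distributions identify G(nabla_X Y + nabla_Y X, Z) with -(L_Z G)(X, Y). In
    canonical coordinates the derivatives of the components of X and Y cancel and
      G(nabla_X Y + nabla_Y X, Z) = - X^a Y^b Z(g_ab)
    remains ([bundle_like_defect]). So G is bundle-like if and only if the derivatives
    of g_ab along the fibres vanish. Now g^ab is block diagonal with blocks g^ij(x, p)
    and f(x) g^{alpha beta}(z, q) ([warped_gup]), and f > 0.

    If both factors are pseudo-Riemannian, then g_ab is locally constant along the
    fibres of the slit bundle, and G is bundle-like
    ([warped_bundle_like_of_riemannian]).

    Conversely, global fields are needed to test the bundle-like condition. Bump functions
    give fields on M with a prescribed value at a point ([frame_field]); their horizontal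
    lifts serve as X and Y ([horizontal_lift]) and the Liouville field p_a d/dp_a as Z.
    The outcome is that g_ab is constant on each open ray (x, t p), t > 0
    ([liouville_derive0]), and so are the blocks of g^ab. Radial information suffices: the
    Hamiltonians are smooth across the zero section, so that letting t tend to 0 gives
    g^ij(x, p) = g^ij(x, 0) for all p ([gup_ray_origin]), and similarly on M2. This
    covers fibres of dimension one, which become disconnected without their origin.

    The lift of a field must be horizontal in every chart. This follows without
    computing how the connection coefficients transform: G has its local form in every
    chart, and the horizontal space is the G-orthogonal complement of the vertical
    one ([delta_p_orthogonal], [horizontal_chart]). *)

(** * Smooth functions on open sets *)

Lemma near_eq_differentiable (R : numFieldType) (V W : normedModType R)
    (f g : V -> W) (x : V) :
  {near x, f =1 g} -> differentiable f x -> differentiable g x.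
Proof.
move=> fg df; have fgx : f x = g x := nbhs_singleton fg.
have [dc dfx] := (diff_locallyP _ _).1 df.
have dg : g \o shift x = cst (g x) + 'd f x +o_ 0 id.
  apply/eqaddoP => e e0; have /eqaddoP/(_ e e0) := dfx.
  have := fg; rewrite -nbhs_nearE near_nbhs (near_shift 0) => fg0.
  apply: filterS2 fg0 => h /=; rewrite !fctE /= subr0 fgx => ->; exact.
have dE := diff_unique dc dg.
by apply/diff_locallyP; split; rewrite dE.
Qed.

Lemma differentiable_rV (R : realType) (V : normedModType R) (e : nat)
    (F : V -> 'rV[R]_e) (x : V) :
  differentiable F x <-> forall j, differentiable (fun y => F y 0 j) x.
Proof.
split=> [dF j|dF].
  exact: (differentiable_comp dF (differentiable_coord _ _ _)).
have -> : F = \sum_(j < e) (fun y => F y 0 j *: (delta_mx 0 j : 'rV[R]_e)).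
  by apply/funext => y; rewrite fct_sumE [LHS]row_sum_delta.
apply: (@differentiable_sum _ _ _ _ (fun j y => F y 0 j *: (delta_mx 0 j : 'rV[R]_e))).
by move=> j; apply: differentiableZl; apply: dF.
Qed.

Lemma derive_rV (R : realType) (V : normedModType R) (e : nat)
    (F : V -> 'rV[R]_e) (x v : V) j :
  differentiable F x -> ('D_v F x) 0 j = 'D_v (fun y => F y 0 j) x.
Proof. by move=> dF; rewrite derive_mx ?mxE //; exact: diff_derivable. Qed.

(** A directional derivative only sees the values along a line, so [F] and [G] may
    even live on different spaces. This transports derivatives between charts,
    along fibres, and to the factors of a product. *)
Lemma derive_along (R : numFieldType) (V V' W : normedModType R)
    (F : V -> W) (G : V' -> W) (x v : V) (x' v' : V') :
  (\forall h \near 0, F (h *: v + x) = G (h *: v' + x')) -> 'D_v F x = 'D_v' G x'.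
Proof.
move=> FG; have FGx : F x = G x'.
  by have := nbhs_singleton FG; rewrite !scale0r !add0r.
have {}FG : \forall h \near 0^', h^-1 *: ((F \o shift x) (h *: v) - F x) =
    h^-1 *: ((G \o shift x') (h *: v') - G x').
  by apply: cvg_within; apply: filterS FG => h /= ->; rewrite FGx.
rewrite /derive; congr (lim _); rewrite eqEsubset.
by split; apply: near_eq_cvg => //; apply: filterS FG => h ->.
Qed.

Lemma derive_affine (R : numFieldType) (V W : normedModType R)
    (F : V -> W) (x v : V) (a : W) :
  (\forall h \near 0, F (h *: v + x) = h *: a + F x) -> 'D_v F x = a.
Proof.
move=> Fa; apply/cvg_lim => //.
have ca : (fun=> a) @ (0^' : set_system R) --> a by exact: cvg_cst.
apply: cvg_trans ca; apply: near_eq_cvg.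
near=> h; rewrite /=.
have -> : F (h *: v + x) = h *: a + F x by near: h; apply: cvg_within.
rewrite addrK scalerA mulVf ?scale1r //.
by near: h; exact: nbhs_dnbhs_neq.
Unshelve. all: by end_near. Qed.

Section SmoothCalculus.
Context {R : realType} {d : nat}.
Implicit Types (A : set 'rV[R]_d) (F G : 'rV[R]_d -> R).

(** Order by order, smoothness can be established by induction: the Leibniz, quotient
    and chain rules express the partial derivatives of a compound function by
    functions of the same kind whose order is one less. *)
Fixpoint Ck (W : normedModType R) (k : nat) A (F : 'rV[R]_d -> W) : Prop :=
  (forall x, A x -> differentiable F x) /\
  if k is k'.+1 then forall i : 'I_d, Ck k' A ('D_(delta_mx 0 i) F) else True.

Lemma Ck_diff (W : normedModType R) k A (F : 'rV[R]_d -> W) :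
  Ck k A F -> forall x, A x -> differentiable F x.
Proof. by case: k => [|k] []. Qed.

Lemma CkW (W : normedModType R) k A (F : 'rV[R]_d -> W) :
  Ck k.+1 A F -> Ck k A F.
Proof.
elim: k F => [|k IH] F [dF DF]; split=> // i.
by apply: IH; apply: DF.
Qed.

Lemma smooth_onP (W : normedModType R) A (F : 'rV[R]_d -> W) :
  smooth_on A F <-> forall k, Ck k A F.
Proof.
split=> [sF k|CF].
  elim: k F sF => [|k IH] F sF; split=> //; try exact: (sF [::]).
  move=> i; apply: IH => s x Ax; have := sF (rcons s i) x Ax.
  by rewrite foldr_rcons.
move=> s; elim/last_ind: s F CF => [|s i IH] F CF x Ax.
  exact: (Ck_diff (CF 0%N)).
rewrite foldr_rcons; apply: IH => // k.
exact: (CF k.+1).2.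
Qed.

Lemma smooth_diff (W : normedModType R) A (F : 'rV[R]_d -> W) :
  smooth_on A F -> forall x, A x -> differentiable F x.
Proof. by move=> /smooth_onP/(_ 0%N)/Ck_diff. Qed.

Lemma smooth_partial (W : normedModType R) A (F : 'rV[R]_d -> W) i :
  smooth_on A F -> smooth_on A ('D_(delta_mx 0 i) F).
Proof. by move=> /smooth_onP CF; apply/smooth_onP => k; exact: (CF k.+1).2. Qed.

Lemma smooth_subset (W : normedModType R) A B (F : 'rV[R]_d -> W) :
  B `<=` A -> smooth_on A F -> smooth_on B F.
Proof. by move=> BA sF s x /BA; apply: sF. Qed.

Lemma open_near_eq (W : normedModType R) A (F G : 'rV[R]_d -> W) x :
  open A -> {in A, F =1 G} -> A x -> {near x, F =1 G}.
Proof.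
move=> oA FG Ax; have : \forall y \near x, A y by exact: open_nbhs_nbhs.
by apply: filterS => y Ay; apply: FG; rewrite inE.
Qed.

Lemma Ck_eq (W : normedModType R) k A (F G : 'rV[R]_d -> W) :
  open A -> {in A, F =1 G} -> Ck k A F -> Ck k A G.
Proof.
move=> oA; elim: k F G => [|k IH] F G FG [dF DF]; split=> //.
- by move=> x Ax; apply: near_eq_differentiable (dF x Ax); exact: (open_near_eq oA).
- by move=> x Ax; apply: near_eq_differentiable (dF x Ax); exact: (open_near_eq oA).
- move=> i; apply: IH (DF i) => x; rewrite inE => Ax.
  by apply: near_eq_derive; apply: (open_near_eq oA).
Qed.

Lemma smooth_eq (W : normedModType R) A (F G : 'rV[R]_d -> W) :
  open A -> {in A, F =1 G} -> smooth_on A F -> smooth_on A G.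
Proof.
by move=> oA FG /smooth_onP CF; apply/smooth_onP => k; apply: Ck_eq (CF k).
Qed.

(** [smooth_on] is a pointwise condition on iterated derivatives. *)
Lemma smooth_local (W : normedModType R) A (F : 'rV[R]_d -> W) :
  (forall x, A x -> exists2 B, B x & smooth_on B F) -> smooth_on A F.
Proof. by move=> loc s x Ax; have [B Bx sF] := loc x Ax; apply: sF. Qed.

Lemma Ck_cst (W : normedModType R) k A (a : W) : Ck k A (fun=> a).
Proof.
elim: k a => [|k IH] a; split=> //; try by move=> x _; exact: differentiable_cst.
move=> i; have -> : 'D_(delta_mx 0 i) (fun=> a) = (fun=> 0) :> ('rV[R]_d -> W).
  by apply/funext => x; exact: derive_cst.
exact: IH.
Qed.

Lemma smooth_cst (W : normedModType R) A (a : W) : smooth_on A (fun=> a).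
Proof. by apply/smooth_onP => k; exact: Ck_cst. Qed.
Arguments smooth_cst {W} A a.

Lemma CkD k A F G : open A -> Ck k A F -> Ck k A G -> Ck k A (fun x => F x + G x).
Proof.
move=> oA; elim: k F G => [|k IH] F G [dF DF] [dG DG].
  by split=> // x Ax; apply: differentiableD; [exact: dF|exact: dG].
split=> [x Ax|i]; first by apply: differentiableD; [exact: dF|exact: dG].
apply: Ck_eq (IH _ _ (DF i) (DG i)) => // x; rewrite inE => Ax.
rewrite (_ : (fun x => F x + G x) = F + G) //.
by rewrite deriveD //; apply: diff_derivable; [exact: dF|exact: dG].
Qed.

Lemma CkM k A F G : open A -> Ck k A F -> Ck k A G -> Ck k A (fun x => F x * G x).
Proof.
move=> oA; elim: k F G => [|k IH] F G CF CG; have dF := Ck_diff CF; have dG := Ck_diff CG.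
  by split=> // x Ax; apply: differentiableM; [exact: dF|exact: dG].
split=> [x Ax|i]; first by apply: differentiableM; [exact: dF|exact: dG].
have C1 := IH _ _ (CkW CF) (CG.2 i); have C2 := IH _ _ (CkW CG) (CF.2 i).
apply: (Ck_eq oA _ (CkD oA C1 C2)).
move=> x; rewrite inE => Ax; rewrite (_ : (fun x => F x * G x) = F * G) //.
by rewrite deriveM //; apply: diff_derivable; [exact: dF|exact: dG].
Qed.

Lemma CkV k A F : open A -> (forall x, A x -> F x != 0) ->
  Ck k A F -> Ck k A (fun x => (F x)^-1).
Proof.
move=> oA F0; elim: k => [|k IH] CF; have dF := Ck_diff CF.
  by split=> // x Ax; apply: differentiableV; [exact: dF|exact: F0].
split=> [x Ax|i]; first by apply: differentiableV; [exact: dF|exact: F0].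
have IH' := IH (CkW CF).
have C0 : Ck k A (fun=> - 1 : R) by exact: Ck_cst.
apply: (Ck_eq oA _ (CkM oA (CkM oA (CkM oA C0 IH') IH') (CF.2 i))).
move=> x; rewrite inE => Ax.
rewrite deriveV; [|exact: F0|by apply: diff_derivable; exact: dF].
by rewrite -exprVn expr2 mulN1r -mulNr.
Qed.

Lemma smoothD A F G : open A -> smooth_on A F -> smooth_on A G ->
  smooth_on A (fun x => F x + G x).
Proof.
by move=> oA /smooth_onP CF /smooth_onP CG; apply/smooth_onP => k; apply: CkD.
Qed.

Lemma smoothM A F G : open A -> smooth_on A F -> smooth_on A G ->
  smooth_on A (fun x => F x * G x).
Proof.
by move=> oA /smooth_onP CF /smooth_onP CG; apply/smooth_onP => k; apply: CkM.
Qed.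

Lemma smoothV A F : open A -> (forall x, A x -> F x != 0) ->
  smooth_on A F -> smooth_on A (fun x => (F x)^-1).
Proof. by move=> oA F0 /smooth_onP CF; apply/smooth_onP => k; apply: CkV. Qed.

Lemma smoothN A F : open A -> smooth_on A F -> smooth_on A (fun x => - F x).
Proof.
move=> oA sF; apply: smooth_eq (smoothM oA (smooth_cst A (- 1 : R)) sF) => // x _.
by rewrite mulN1r.
Qed.

Lemma smoothB A F G : open A -> smooth_on A F -> smooth_on A G ->
  smooth_on A (fun x => F x - G x).
Proof. by move=> oA sF sG; apply: smoothD => //; apply: smoothN. Qed.

Lemma smooth_sum A (I : Type) (r : seq I) (P : pred I) (F : I -> 'rV[R]_d -> R) :
  open A -> (forall i, smooth_on A (F i)) ->
  smooth_on A (fun x => \sum_(i <- r | P i) F i x).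
Proof.
move=> oA sF; elim: r => [|i r IH].
  by apply: smooth_eq (smooth_cst A (0 : R)) => // x _; rewrite big_nil.
case Pi : (P i).
  by apply: smooth_eq (smoothD oA (sF i) IH) => // x _; rewrite big_cons Pi.
by apply: smooth_eq IH => // x _; rewrite big_cons Pi.
Qed.

Lemma smooth_prod A (I : Type) (r : seq I) (P : pred I) (F : I -> 'rV[R]_d -> R) :
  open A -> (forall i, smooth_on A (F i)) ->
  smooth_on A (fun x => \prod_(i <- r | P i) F i x).
Proof.
move=> oA sF; elim: r => [|i r IH].
  by apply: smooth_eq (smooth_cst A (1 : R)) => // x _; rewrite big_nil.
case Pi : (P i).
  by apply: smooth_eq (smoothM oA (sF i) IH) => // x _; rewrite big_cons Pi.
by apply: smooth_eq IH => // x _; rewrite big_cons Pi.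
Qed.

Lemma smooth_coord A (j : 'I_d) : open A -> smooth_on A (fun x => x 0 j).
Proof.
move=> oA; apply/smooth_onP => -[|k]; split=> //.
- by move=> x _; exact: differentiable_coord.
- by move=> x _; exact: differentiable_coord.
move=> i; apply: Ck_eq (Ck_cst _ _ ((delta_mx 0 i : 'rV[R]_d) 0 j)) => // x _.
rewrite deriveE; last exact: differentiable_coord.
have @f : {linear 'rV[R]_d -> R}.
  by exists (fun N : 'rV[R]_d => N 0 j); do 2![eexists]; do ?[constructor];
     rewrite ?mxE// => ? *; rewrite ?mxE//; move=> ?; rewrite !mxE.
rewrite (_ : (fun _ => _) = f) // diff_lin //; exact: coord_continuous.
Qed.

Lemma Ck_rV (e : nat) k A (F : 'rV[R]_d -> 'rV[R]_e) : open A ->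
  Ck k A F <-> forall j, Ck k A (fun x => F x 0 j).
Proof.
move=> oA; elim: k F => [|k IH] F; split.
- by move=> [dF _] j; split=> // x Ax; apply/(differentiable_rV F x).1/dF.
- by move=> CF; split=> // x Ax; apply/differentiable_rV => j; exact: (CF j).1.
- move=> [dF DF] j; split=> [x Ax|i]; first exact/(differentiable_rV F x).1/dF.
  apply: Ck_eq ((IH _).1 (DF i) j) => // x; rewrite inE => Ax.
  by rewrite derive_rV //; exact: dF.
- move=> CF; have dF x : A x -> differentiable F x.
    by move=> Ax; apply/differentiable_rV => j; exact: (CF j).1.
  split=> // i; apply/IH => j; apply: Ck_eq ((CF j).2 i) => // x; rewrite inE => Ax.
  by rewrite derive_rV //; exact: dF.
Qed.

Lemma smooth_rV (e : nat) A (F : 'rV[R]_d -> 'rV[R]_e) : open A ->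
  smooth_on A F <-> forall j, smooth_on A (fun x => F x 0 j).
Proof.
move=> oA; split=> [/smooth_onP CF j|sF]; apply/smooth_onP => k.
  by apply/(Ck_rV _ _ _).1.
by apply/Ck_rV => // j; have /smooth_onP := sF j.
Qed.

Lemma smooth_det (n : nat) A (M : 'rV[R]_d -> 'M[R]_n) : open A ->
  (forall i j, smooth_on A (fun x => M x i j)) -> smooth_on A (fun x => \det (M x)).
Proof.
move=> oA sM; rewrite /determinant; apply: smooth_sum => // s.
apply: smoothM => //; first exact: smooth_cst.
by apply: smooth_prod.
Qed.

Lemma smooth_mulmx (p q r : nat) A (M : 'rV[R]_d -> 'M[R]_(p, q))
    (N : 'rV[R]_d -> 'M[R]_(q, r)) : open A ->
  (forall i j, smooth_on A (fun x => M x i j)) ->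
  (forall i j, smooth_on A (fun x => N x i j)) ->
  forall i j, smooth_on A (fun x => (M x *m N x) i j).
Proof.
move=> oA sM sN i j.
apply: smooth_eq (_ : smooth_on A (fun x => \sum_k M x i k * N x k j)) => //.
  by move=> x _; rewrite mxE.
by apply: smooth_sum => // k; apply: smoothM.
Qed.

(** Cramer's rule leaves determinants and one scalar division. *)
Lemma smooth_invmx (n : nat) A (M : 'rV[R]_d -> 'M[R]_n) : open A ->
  (forall x, A x -> M x \in unitmx) ->
  (forall i j, smooth_on A (fun x => M x i j)) ->
  forall i j, smooth_on A (fun x => invmx (M x) i j).
Proof.
move=> oA uM sM i j.
apply: smooth_eq (_ : smooth_on A (fun x =>
  (\det (M x))^-1 * ((-1) ^+ (j + i) * \det (row' j (col' i (M x)))))) => //.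
  by move=> x; rewrite inE => /uM uMx; rewrite /invmx uMx !mxE.
apply: smoothM => //; last first.
  apply: smoothM => //; first exact: smooth_cst.
  apply: smooth_det => // k l.
  by apply: smooth_eq (sM (lift j k) (lift i l)) => // x _; rewrite !mxE.
apply: smoothV => //; last exact: smooth_det.
by move=> x /uM; rewrite unitmxE unitfE.
Qed.

End SmoothCalculus.
Arguments smooth_cst {R d W} A a.

Section Composition.
Context {R : realType} {d e : nat}.

Lemma derive_comp (F : 'rV[R]_e -> R)
    (Phi : 'rV[R]_d -> 'rV[R]_e) x v :
  differentiable Phi x -> differentiable F (Phi x) ->
  'D_v (F \o Phi) x = \sum_(j < e) 'D_(delta_mx 0 j) F (Phi x) * 'D_v (fun y => Phi y 0 j) x.
Proof.
move=> dPhi dF; rewrite deriveE; last exact: differentiable_comp.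
rewrite diff_comp //=; set u := 'd Phi x v.
have uE j : 'D_v (fun y => Phi y 0 j) x = u 0 j by rewrite -derive_rV // deriveE.
rewrite [in LHS](row_sum_delta u) linear_sum.
by apply: eq_bigr => j _; rewrite linearZ /= -deriveE // mulrC uE.
Qed.

(** The partial derivatives of [F \o Phi] are sums of products of derivatives of [Phi]
    with compositions in which a derivative of [F] replaces [F]; this is why [F] varies
    in the induction on the order. *)
Lemma smooth_comp (A : set 'rV[R]_d) (B : set 'rV[R]_e) (F : 'rV[R]_e -> R)
    (Phi : 'rV[R]_d -> 'rV[R]_e) :
  open A -> (forall x, A x -> B (Phi x)) ->
  smooth_on B F -> smooth_on A Phi -> smooth_on A (F \o Phi).
Proof.
move=> oA AB sF sPhi; apply/smooth_onP => k.
have dPhi := smooth_diff sPhi.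
have {sPhi} sPhi : forall j, smooth_on A (fun x => Phi x 0 j) by apply/smooth_rV.
elim: k F sF => [|k IH] F sF; have dF := smooth_diff sF.
  by split=> // x Ax; apply: differentiable_comp; [exact: dPhi|apply: dF; exact: AB].
split=> [x Ax|i].
  by apply: differentiable_comp; [exact: dPhi|apply: dF; exact: AB].
apply: Ck_eq (_ : Ck k A (fun x => \sum_(j < e) ('D_(delta_mx 0 j) F \o Phi) x *
    'D_(delta_mx 0 i) (fun y => Phi y 0 j) x)) => //.
  move=> x; rewrite inE => Ax; rewrite derive_comp //; [exact: dPhi|exact/dF/AB].
elim: (index_enum _) => [|j r IHr].
  by apply: Ck_eq (Ck_cst _ _ 0) => // x _; rewrite big_nil.
apply: Ck_eq (CkD oA (CkM oA (IH _ (smooth_partial j sF)) (_ : Ck k A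
  ('D_(delta_mx 0 i) (fun y => Phi y 0 j)))) IHr) => //.
  by move=> x _; rewrite big_cons.
by have /smooth_onP := smooth_partial i (sPhi j).
Qed.

End Composition.

Lemma smooth_compV (R : realType) (d e f : nat) (A : set 'rV[R]_d) (B : set 'rV[R]_e)
    (F : 'rV[R]_e -> 'rV[R]_f) (Phi : 'rV[R]_d -> 'rV[R]_e) :
  open A -> open B -> (forall x, A x -> B (Phi x)) ->
  smooth_on B F -> smooth_on A Phi -> smooth_on A (F \o Phi).
Proof.
move=> oA oB AB sF sPhi; apply/smooth_rV => // j.
by apply: (smooth_comp (B := B) (F := fun y => F y 0 j)) => //; exact: (smooth_rV _ oB).1.
Qed.

Lemma smooth_jacobian (R : realType) (d e : nat) (A : set 'rV[R]_d)
    (F : 'rV[R]_d -> 'rV[R]_e) i j :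
  open A -> smooth_on A F -> smooth_on A (fun x => jacobian F x i j).
Proof.
move=> oA sF; have dF := smooth_diff sF.
apply: smooth_eq (_ : smooth_on A (fun x => ('D_(delta_mx 0 i) F x) 0 j)) => //.
  by move=> x; rewrite inE => Ax; rewrite (deriveEjacobian _ (dF x Ax)) -rowE mxE.
by move: j; apply/(smooth_rV _ oA).1; apply: smooth_partial.
Qed.

Lemma delta_rshift (R : realType) (k l : nat) (j : 'I_l) :
  (delta_mx 0 (rshift k j) : 'rV[R]_(k + l)) = row_mx 0 (delta_mx 0 j).
Proof.
apply/rowP => i; case: (splitP i) => a ia.
  have -> : i = lshift l a by apply: val_inj.
  by rewrite row_mxEl !mxE eqxx eq_lrshift.
have -> : i = rshift k a by apply: val_inj.
by rewrite row_mxEr !mxE eqxx eq_rshift.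
Qed.

Lemma delta_lshift (R : realType) (k l : nat) (j : 'I_k) :
  (delta_mx 0 (lshift l j) : 'rV[R]_(k + l)) = row_mx (delta_mx 0 j) 0.
Proof.
apply/rowP => i; case: (splitP i) => a ia.
  have -> : i = lshift l a by apply: val_inj.
  by rewrite row_mxEl !mxE eqxx eq_lshift.
have -> : i = rshift k a by apply: val_inj.
by rewrite row_mxEr !mxE eqxx eq_rlshift.
Qed.

Lemma smooth_row_mx (R : realType) (d e f : nat) (A : set 'rV[R]_d)
    (F : 'rV[R]_d -> 'rV[R]_e) (G : 'rV[R]_d -> 'rV[R]_f) :
  open A -> smooth_on A F -> smooth_on A G ->
  smooth_on A (fun x => row_mx (F x) (G x)).
Proof.
move=> oA sF sG; apply/smooth_rV => // j.
case: (splitP j) => k jk.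
  have -> : j = lshift f k by apply: val_inj.
  apply: smooth_eq (_ : smooth_on A (fun x => F x 0 k)) => //.
    by move=> x _; rewrite row_mxEl.
  by move: k {jk}; apply/(smooth_rV _ oA).1.
have -> : j = rshift e k by apply: val_inj.
apply: smooth_eq (_ : smooth_on A (fun x => G x 0 k)) => //.
  by move=> x _; rewrite row_mxEr.
by move: k {jk}; apply/(smooth_rV _ oA).1.
Qed.

Lemma smooth_lsubmx (R : realType) (d e : nat) (A : set 'rV[R]_(d + e)) :
  open A -> smooth_on A (@lsubmx R 1 d e).
Proof.
move=> oA; apply/smooth_rV => // j.
by apply: smooth_eq (smooth_coord (lshift e j) oA) => // x _; rewrite mxE.
Qed.

Lemma smooth_rsubmx (R : realType) (d e : nat) (A : set 'rV[R]_(d + e)) :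
  open A -> smooth_on A (@rsubmx R 1 d e).
Proof.
move=> oA; apply/smooth_rV => // j.
by apply: smooth_eq (smooth_coord (rshift d j) oA) => // x _; rewrite mxE.
Qed.

Lemma smooth_rowmul (R : realType) (d e f : nat) (A : set 'rV[R]_d)
    (F : 'rV[R]_d -> 'rV[R]_e) (M : 'rV[R]_d -> 'M[R]_(e, f)) :
  open A -> smooth_on A F -> (forall i j, smooth_on A (fun x => M x i j)) ->
  smooth_on A (fun x => F x *m M x).
Proof.
move=> oA sF sM; apply/smooth_rV => // j; apply: smooth_mulmx => // i k.
by rewrite (ord1 i); move: k; apply/(smooth_rV _ oA).1.
Qed.

Lemma derive_chain (R : numFieldType) (U V W : normedModType R)
    (f : U -> V) (g : V -> W) (x v : U) :
  differentiable f x -> differentiable g (f x) ->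
  'D_v (g \o f) x = 'D_('D_v f x) g (f x).
Proof.
move=> df dg; rewrite deriveE; last exact: differentiable_comp.
by rewrite diff_comp //= -!deriveE.
Qed.

(** * Atlases and cotangent bundles *)

(** The part of the notion of a smooth manifold that involves no topology on [T]. It also
    holds for the cotangent bundle, where covectors are stored by their components in
    the chart selected at the base point: this selection may jump, so that canonical
    charts need not be continuous for the product topology. *)
Record smooth_atlas (R : realType) (d : nat) (T : Type) (A : atlas R d T) : Prop := {
  atlas_cover : forall x : T, dom (chart_at A x) x;
  atlas_crdK : forall (c : idx A) x, dom c x -> inv c (crd c x) = x;
  atlas_open : forall c c' : idx A, open (chart_img c (dom c'));
  atlas_transition : forall c c' : idx A,
    smooth_on (chart_img c (dom c')) (crd c' \o @inv _ _ _ A c)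
}.

Arguments atlas_transition {R d T A} _ c c'.
Arguments atlas_open {R d T A} _ c c'.

Opaque jacobian diff derive.

(** Jacobian at [x] of the change from [c] to [c']. It acts on row vectors from the right,
    so a change of charts followed by another is the product in reading order. *)
HB.lock Definition tjac (R : realType) (d : nat) (T : Type) (A : atlas R d T)
    (c c' : idx A) (x : T) : 'M[R]_d :=
  jacobian (crd c' \o @inv _ _ _ A c) (crd c x).

Section Atlas.
Context {R : realType} {d : nat} {T : Type} (A : atlas R d T).
Hypothesis hA : smooth_atlas A.
Implicit Types (c : idx A) (U : set T) (x : T) (y : 'rV[R]_d).

Lemma chart_imgP c U y :
  chart_img c U y <-> [/\ dom c (inv c y), U (inv c y) & crd c (inv c y) = y].
Proof.
split=> [[x [dx Ux] <-]|[dy Uy <-]]; first by rewrite (atlas_crdK hA).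
by exists (inv c y).
Qed.

Lemma chart_img_crd c U x : dom c x -> U x -> chart_img c U (crd c x).
Proof. by move=> dx Ux; exists x. Qed.

Lemma chart_imgS c U V : U `<=` V -> chart_img c U `<=` chart_img c V.
Proof. by move=> UV y [x [dx Ux] <-]; exists x; split => //; apply: UV. Qed.

Lemma near_overlap c c' x : dom c x -> dom c' x ->
  \forall y \near crd c x, chart_img c (dom c') y.
Proof.
move=> dx dx'; apply: open_nbhs_nbhs; split; first exact: atlas_open.
exact: chart_img_crd.
Qed.

Lemma transition_diff c c' x : dom c x -> dom c' x ->
  differentiable (crd c' \o @inv _ _ _ A c) (crd c x).
Proof.
move=> dx dx'; apply: (smooth_diff (atlas_transition hA c c')).
exact: chart_img_crd.
Qed.

Lemma tjac_derive c c' x v : dom c x -> dom c' x ->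
  v *m tjac c c' x = 'D_v (crd c' \o @inv _ _ _ A c) (crd c x).
Proof. by move=> dx dx'; rewrite tjac.unlock deriveEjacobian //; exact: transition_diff. Qed.

Lemma tjac_comp c c' c'' x : dom c x -> dom c' x -> dom c'' x ->
  tjac c c' x *m tjac c' c'' x = tjac c c'' x.
Proof.
move=> dx dx' dx''; apply/row_matrixP => i; rewrite !rowE mulmxA.
rewrite (tjac_derive _ dx dx').
rewrite (tjac_derive _ dx' dx'').
rewrite (tjac_derive _ dx dx'').
have e2 : (crd c' \o @inv _ _ _ A c) (crd c x) = crd c' x by rewrite /= (atlas_crdK hA).
rewrite -e2 -derive_chain; last by rewrite e2; exact: transition_diff.
  apply: near_eq_derive.
  near=> y; have : chart_img c (dom c') y by near: y; exact: near_overlap.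
  by move=> /chart_imgP[dy dy' _]; rewrite /= (atlas_crdK hA).
exact: transition_diff.
Unshelve. all: by end_near. Qed.

Lemma tjac_id c x : dom c x -> tjac c c x = 1%:M.
Proof.
move=> dx; apply/row_matrixP => i; rewrite !rowE mulmx1 tjac_derive //.
rewrite -[RHS](derive_id (crd c x) (delta_mx 0 i)).
apply: near_eq_derive.
near=> y; have : chart_img c (dom c) y by near: y; exact: near_overlap.
by move=> /chart_imgP[_ _ yE].
Unshelve. all: by end_near. Qed.

Lemma tjacK c c' x : dom c x -> dom c' x -> tjac c c' x *m tjac c' c x = 1%:M.
Proof. by move=> dx dx'; rewrite tjac_comp // tjac_id. Qed.

Lemma tjac_unit c c' x : dom c x -> dom c' x -> tjac c c' x \in unitmx.
Proof. by move=> dx dx'; have [] := mulmx1_unit (tjacK dx dx'). Qed.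

Lemma tjac_smooth c c' i j :
  smooth_on (chart_img c (dom c')) (fun y => tjac c c' (inv c y) i j).
Proof.
have oO := atlas_open hA c c'.
apply: (smooth_eq oO _ (smooth_jacobian i j oO (atlas_transition hA c c'))).
by move=> y; rewrite inE => /chart_imgP[_ _ yE]; rewrite tjac.unlock yE.
Qed.

Arguments tjac_smooth c c' i j : clear implicits.

Lemma tjac_smooth_inv c c' i j :
  smooth_on (chart_img c (dom c')) (fun y => tjac c' c (inv c y) i j).
Proof.
apply: smooth_eq (_ : smooth_on _ (fun y => invmx (tjac c c' (inv c y)) i j)).
- exact: atlas_open.
- move=> y; rewrite inE => /chart_imgP[dy dy' _].
  have u := tjac_unit dy dy'; congr (fun_of_matrix _ i j).
  by rewrite -[LHS]mulmx1 -(tjacK dy dy') mulKmx.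
- apply: smooth_invmx; first exact: atlas_open.
    by move=> y /chart_imgP[dy dy' _]; apply: tjac_unit.
  by move=> k l; apply: tjac_smooth.
Qed.

Lemma tcompE c x (v : 'rV[R]_d) : tcomp c x v = v *m tjac (chart_at A x) c x.
Proof. by rewrite tjac.unlock. Qed.

Lemma tcomp_chart_at x (v : 'rV[R]_d) : tcomp (chart_at A x) x v = v.
Proof. by rewrite tcompE tjac_id ?mulmx1 //; apply: atlas_cover. Qed.

Lemma chart_img_open_total c : open (chart_img c setT).
Proof.
suff -> : chart_img c setT = chart_img c (dom c) by exact: atlas_open.
by apply/seteqP; split=> y /chart_imgP[dy _ yE]; apply/chart_imgP.
Qed.

End Atlas.

Section Cotangent.
Context {R : realType} {n : nat} {T : Type} (A : atlas R n T).
Hypothesis hA : smooth_atlas A.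
Local Notation CA := (cotangent A).
Implicit Types (c : idx A) (u : T * 'rV[R]_n) (w : 'rV[R]_(n + n)).

Lemma cot_crdE c u : crd (a := CA) c u =
  row_mx (crd c u.1) (u.2 *m (tjac c (chart_at A u.1) u.1)^T).
Proof. by rewrite tjac.unlock. Qed.

Lemma cot_invE c w : inv (a := CA) c w =
  (inv c (lsubmx w), rsubmx w *m (tjac (chart_at A (inv c (lsubmx w))) c (inv c (lsubmx w)))^T).
Proof. by rewrite tjac.unlock. Qed.

Lemma cot_crdK c u : dom c u.1 -> inv (a := CA) c (crd (a := CA) c u) = u.
Proof.
move=> du; rewrite cot_invE cot_crdE row_mxKl row_mxKr (atlas_crdK hA) //.
have du' := atlas_cover hA u.1.
by rewrite -mulmxA -trmx_mul tjacK // trmx1 mulmx1 -surjective_pairing.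
Qed.

(** The chart selected at the base point cancels, and what remains is the usual law: the
    position follows the change of charts and the momentum its inverse transpose. *)
Lemma cot_transitionE c c' w : dom c (inv c (lsubmx w)) -> dom c' (inv c (lsubmx w)) ->
  crd (a := CA) c' (inv (a := CA) c w) =
  row_mx (crd c' (inv c (lsubmx w))) (rsubmx w *m (tjac c' c (inv c (lsubmx w)))^T).
Proof.
move=> dw dw'; rewrite cot_invE cot_crdE /= -mulmxA -trmx_mul.
by rewrite tjac_comp //; apply: atlas_cover.
Qed.

Lemma cot_chart_imgP c (U : set (T * 'rV[R]_n)) w :
  chart_img (A := CA) c U w <-> chart_img c setT (lsubmx w) /\ U (inv (a := CA) c w).
Proof.
split=> [[u [du Uu] <-]|[/(chart_imgP hA)[dw _ wE] Uw]].
  rewrite cot_crdK //; split=> //; rewrite cot_crdE row_mxKl.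
  exact: chart_img_crd.
exists (inv (a := CA) c w) => //.
rewrite cot_transitionE // wE tjac_id // trmx1 mulmx1; exact: hsubmxK.
Qed.

Lemma cot_chart_img_dom c c' w :
  chart_img (A := CA) c (dom (a := CA) c') w <-> chart_img c (dom c') (lsubmx w).
Proof.
split=> [/cot_chart_imgP[/(chart_imgP hA)[dw _ wE] dw']|/(chart_imgP hA)[dw dw' wE]].
  by apply/chart_imgP.
by apply/cot_chart_imgP; split=> //; apply/chart_imgP.
Qed.

Lemma cot_open (B : set 'rV[R]_n) : open B -> open (@lsubmx R 1 n n @^-1` B).
Proof. by move=> oB; apply: open_comp oB => x _; exact: continuous_lsubmx. Qed.

Lemma cot_smooth_atlas : smooth_atlas CA.
Proof.
have oE c c' : chart_img (A := CA) c (dom (a := CA) c') =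
    @lsubmx R 1 n n @^-1` (chart_img c (dom c')).
  by apply/seteqP; split=> w /cot_chart_img_dom.
have oD c c' : open (chart_img (A := CA) c (dom (a := CA) c')).
  by rewrite oE; apply/cot_open/atlas_open.
have lD (c c' : idx A) w : chart_img (A := CA) c (dom (a := CA) c') w ->
    chart_img c (dom c') (lsubmx w).
  by move=> /cot_chart_img_dom.
split=> //.
- by move=> u; exact: (atlas_cover hA).
- by move=> c u; exact: cot_crdK.
move=> c c'; change (idx A) in c, c'; have oO := oD c c'; set O := chart_img _ _.
apply: (smooth_eq (F := fun w : 'rV[R]_(n + n) => row_mx
   (crd c' (inv c (lsubmx w))) (rsubmx w *m (tjac c' c (inv c (lsubmx w)))^T))) => //.
  move=> w; rewrite inE => /lD/(chart_imgP hA)[dw dw' _].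
  by rewrite /= -cot_transitionE.
apply: smooth_row_mx => //.
  apply: (smooth_compV (B := chart_img c (dom c'))
    (F := crd c' \o @inv _ _ _ A c) (Phi := @lsubmx R 1 n n)) => //.
  - exact: atlas_open.
  - exact: lD.
  - exact: atlas_transition.
  - exact: smooth_lsubmx.
apply: smooth_rowmul => //; first exact: smooth_rsubmx.
move=> i j; apply: (smooth_eq (F := (fun y => tjac c' c (inv c y) j i) \o @lsubmx R 1 n n)) => //.
  by move=> w _; rewrite /= mxE.
apply: (smooth_comp (B := chart_img c (dom c'))) => //.
- exact: lD.
- exact: tjac_smooth_inv.
- exact: smooth_lsubmx.
Qed.

(** The position part of a change of canonical charts does not involve momenta, so the
    base components of a tangent vector of T^*M transform as on M. *)
Lemma lsubmx_tjac c c' u (v : 'rV[R]_(n + n)) : dom c u.1 -> dom c' u.1 ->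
  lsubmx (v *m tjac (A := CA) c c' u) = lsubmx v *m tjac c c' u.1.
Proof.
move=> du du'; have dw := transition_diff cot_smooth_atlas du du'.
rewrite (tjac_derive cot_smooth_atlas) //; apply/rowP => j; rewrite !mxE derive_rV //.
have db := transition_diff hA du du'.
transitivity ((lsubmx v *m tjac c c' u.1) 0 j); last by rewrite !mxE.
rewrite tjac_derive // derive_rV //.
apply: derive_along; near=> h; rewrite /comp cot_crdE.
by rewrite row_mxEl cot_invE /= linearP /= row_mxKl.
Unshelve. all: by end_near. Qed.

(** A change of canonical charts is linear in the momentum, so its derivative in the
    radial direction reproduces the momentum: the Liouville field p_a d/dp_a has the same
    expression in all canonical charts. *)
Lemma liouville_tjac c c' u : dom c u.1 -> dom c' u.1 ->
  row_mx 0 (rsubmx (crd (a := CA) c u)) *m tjac (A := CA) c c' u =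
  row_mx 0 (rsubmx (crd (a := CA) c' u)) :> 'rV_(n + n).
Proof.
move=> du du'; have [w wE] : exists w, w = crd (a := CA) c u by eexists.
have [v vE] : exists v, v = row_mx 0 (rsubmx w) :> 'rV[R]_(n + n) by eexists.
rewrite -[X in row_mx _ (rsubmx X) *m _]wE -[X in X *m _]vE.
have lv : lsubmx v = 0 by rewrite vE row_mxKl.
have rv : rsubmx v = rsubmx w by rewrite vE row_mxKr.
have iw : inv (a := CA) c w = u by rewrite wE; exact: cot_crdK.
have lw : inv c (lsubmx w) = u.1 by rewrite wE cot_crdE row_mxKl (atlas_crdK hA).
rewrite -[LHS]hsubmxK lsubmx_tjac // lv mul0mx; congr (row_mx _ _).
have dw := transition_diff cot_smooth_atlas du du'.
rewrite (tjac_derive cot_smooth_atlas) //; apply/rowP => j; rewrite [LHS]mxE derive_rV // -wE.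
have tr : forall w', lsubmx w' = lsubmx w ->
    (crd (a := CA) c' (inv (a := CA) c w')) 0 (rshift n j) =
    (rsubmx w' *m (tjac c' c u.1)^T) 0 j.
  by move=> w' lw'; rewrite cot_transitionE // lw' lw // row_mxEr.
transitivity ((rsubmx w *m (tjac c' c u.1)^T) 0 j); last first.
  by rewrite -(tr w erefl) iw [RHS]mxE.
apply: derive_affine; near=> h; rewrite /comp.
have lh : lsubmx (h *: v + w) = lsubmx w by rewrite linearP /= lv scaler0 add0r.
transitivity ((rsubmx (h *: v + w) *m (tjac c' c u.1)^T) 0 j); first exact: tr lh.
transitivity (h *: (rsubmx w *m (tjac c' c u.1)^T) 0 j + (rsubmx w *m (tjac c' c u.1)^T) 0 j).
  by rewrite linearP /= rv mulmxDl -scalemxAl mxE [X in X + _]mxE.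
by congr (_ + _); symmetry; exact: (tr w erefl).
Unshelve. all: by end_near. Qed.

End Cotangent.

(** * Bump functions and global vector fields *)

Section Flat.
Context {R : realType}.

(** The functions t^-k exp(-1/t), extended by 0. Together they are closed under
    differentiation, which reduces the smoothness of exp(-1/t) to an induction. *)
Definition flat (k : nat) (t : R) : R :=
  if 0 < t then t^-1 ^+ k * expR (- t^-1) else 0.

Lemma flat_le0 k t : t <= 0 -> flat k t = 0.
Proof. by rewrite /flat ltNge => ->. Qed.

(** For t > 0, exp(1/t) exceeds the term of order k+2 of its series; what is left
    is quadratic in t, so the derivative at 0 exists and vanishes. *)
Lemma flat_quadratic k t : `|flat k t| <= (k.+2)`!%:R * t ^+ 2.
Proof.
rewrite /flat; case: ltP => [t0|_]; last by rewrite normr0 mulr_ge0 ?sqr_ge0.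
have ti0 : 0 < t^-1 by rewrite invr_gt0.
rewrite ger0_norm; last by rewrite mulr_ge0 ?expR_ge0 // exprn_ge0 // ltW.
have := expR_ge1Dxn k.+1 (ltW ti0); set e := expR t^-1; set f : R := (k.+2)`!%:R => le_e.
have e0 : 0 < e := expR_gt0 _.
have f0 : 0 < f by rewrite ltr0n fact_gt0.
rewrite expRN ler_pdivrMr // -/e.
have -> : t^-1 ^+ k = f * t ^+ 2 * (t^-1 ^+ k.+2 / f).
  transitivity (t^-1 ^+ k * (t * t^-1) ^+ 2 * (f / f)).
    by rewrite !divff ?gt_eqF // expr1n !mulr1.
  by rewrite !exprS; ring.
apply: ler_wpM2l; first by rewrite mulr_ge0 ?sqr_ge0 ?(ltW f0).
by apply: le_trans le_e; rewrite lerDr.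
Qed.

Lemma is_derive_flat k (t : R) :
  is_derive t 1 (flat k) (flat k.+2 t - k%:R * flat k.+1 t).
Proof.
have [t0|t0|->] := ltgtP t 0.
- rewrite !flat_le0 ?ltW // mulr0 subr0.
  apply: (@near_eq_is_derive _ _ _ (cst 0)).
  by near=> s; rewrite flat_le0 // ltW //; near: s; exact: lt_nbhsl.
- rewrite /flat t0.
  apply: (@near_eq_is_derive _ _ _ ((fun x => x ^+ k * expR (- x)) \o (fun s => s^-1))).
    near=> s; have -> : 0 < s by near: s; exact: lt_nbhsr.
    by [].
  have tn0 : t != 0 by rewrite gt_eqF.
  have dV : is_derive t 1 (fun s : R => s^-1) (- (t^-1 ^+ 2)).
    apply: DeriveDef; first by apply: derivableV => //; exact: derivable_id.
    have idd : derivable (id : R -> R) t 1 := @derivable_id _ _ t 1.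
    have := @deriveV _ _ id t 1 tn0 idd; rewrite derive_id => ->.
    by rewrite exprVn /GRing.scale /= mulr1.
  have dE : is_derive t^-1 1 (fun x => x ^+ k * expR (- x))
     (t^-1 ^+ k * (expR (- t^-1) * -1) + expR (- t^-1) * (k%:R * t^-1 ^+ k.-1)).
    have d1 : is_derive t^-1 1 (expR \o -%R) (expR (- t^-1) * -1).
      exact: (@is_derive1_comp _ expR -%R).
    have d2 := @is_deriveX _ _ _ k _ _ _ (is_derive_id t^-1 (1 : R)).
    have -> : (fun x : R => x ^+ k * expR (- x)) = (id ^+ k) * (expR \o -%R).
      by apply/funext => x; rewrite mulrfctE exprfctE.
    apply: is_derive_eq (is_deriveM d2 d1) _.
    by rewrite !exprfctE /= /GRing.scale /= mulr1.
  apply: is_derive_eq (is_derive1_comp dE dV) _.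
  rewrite !exprS; case: k {dE} => [|k] /=; first by ring.
  by rewrite !exprS; ring.
- rewrite !flat_le0 // mulr0 subr0.
  have c0 : (fun h => h^-1 *: ((flat k \o shift 0) (h *: 1) - flat k 0))
      @ (0^' : set_system R) --> (0:R).
    apply: (@cvg_to_0_linear _ _ (k.+2)`!%:R 1) => // h /andP[h0 _].
    rewrite /= [flat k 0]flat_le0 // subr0 addr0 /GRing.scale /= mulr1 normrM normfV.
    rewrite ler_pdivrMl //; apply: le_trans (flat_quadratic _ _) _.
    by rewrite -real_normK ?num_real // expr2 mulrCA.
  by apply: DeriveDef; [apply/cvg_ex; exists 0|apply/cvg_lim].
Unshelve. all: by end_near. Qed.
End Flat.

Section FlatComp.
Context {R : realType} {d : nat}.

Lemma Ck_flat_comp (A : set 'rV[R]_d) (q : 'rV[R]_d -> R) m k :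
  open A -> smooth_on A q -> Ck m A (flat k \o q).
Proof.
move=> oA sq; have dq := smooth_diff sq.
have dF j x : A x -> differentiable (flat j \o q) x.
  move=> Ax; apply: differentiable_comp; first exact: dq.
  by apply/derivable1_diffP; apply: ex_derive; exact: is_derive_flat.
elim: m k => [|m IH] k; first by split=> //; exact: dF.
split=> [x|i]; first exact: dF.
have sqi : Ck m A ('D_(delta_mx 0 i) q).
  by have /smooth_onP := smooth_partial i sq.
have Cc : Ck m A (fun=> k%:R : R) by exact: Ck_cst.
have Cm : Ck m A (fun=> -1 : R) by exact: Ck_cst.
apply: (Ck_eq oA _ (CkM oA (CkD oA (IH k.+2)
   (CkM oA Cm (CkM oA Cc (IH k.+1)))) sqi)).
move=> x; rewrite inE => Ax.
have df : differentiable (flat k) (q x).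
  by apply/derivable1_diffP; apply: ex_derive; exact: is_derive_flat.
rewrite [RHS](@derive_chain _ _ _ _ q (flat k)) //; last exact: dq.
set h := 'D_(delta_mx 0 i) q x; have -> : 'D_h (flat k) (q x) = h *: 'D_1 (flat k) (q x).
  by rewrite !deriveE // -linearZ /GRing.scale /= mulr1.
by rewrite (@derive_val _ _ _ _ _ _ _ (is_derive_flat k (q x))) /GRing.scale /= mulrC mulN1r.
Qed.

Lemma smooth_flat_comp (A : set 'rV[R]_d) (q : 'rV[R]_d -> R) k :
  open A -> smooth_on A q -> smooth_on A (flat k \o q).
Proof. by move=> oA sq; apply/smooth_onP => m; apply: Ck_flat_comp. Qed.

(** Evaluate [flat 0] at r^2 minus the squared Euclidean distance to [y0]; the norm of 'rV
    is the supremum norm, which is at most the Euclidean one. *)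
Lemma smooth_bump (y0 : 'rV[R]_d) (r : R) : 0 < r ->
  exists psi : 'rV[R]_d -> R, [/\ smooth_on setT psi, psi y0 != 0
    & forall y, psi y != 0 -> `|y0 - y| <= r].
Proof.
move=> r0; pose q (y : 'rV[R]_d) := r ^+ 2 - \sum_j (y 0 j - y0 0 j) * (y 0 j - y0 0 j).
exists (flat 0 \o q); split.
- apply: smooth_flat_comp; first exact: openT.
  apply: smoothB; [exact: openT|exact: smooth_cst|].
  have sc j : smooth_on setT (fun y : 'rV[R]_d => y 0 j - y0 0 j).
    by apply: smoothB; [exact: openT|apply: smooth_coord; exact: openT|exact: smooth_cst].
  by apply: smooth_sum => [|j]; [exact: openT|apply: smoothM => //; exact: openT].
- rewrite /= /q big1 => [|j _]; last by rewrite subrr mulr0.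
  by rewrite subr0 /flat exprn_gt0 // expr0 mul1r gt_eqF // expR_gt0.
move=> y; rewrite /= /flat; case: ltP => [q0 _|_]; last by rewrite eqxx.
rewrite [leLHS]/Num.Def.normr /= mx_normrE; apply: bigmax_le; first exact: ltW.
move=> [i j] _ /=; rewrite (ord1 i) !mxE distrC.
rewrite -(ler_pXn2r (_ : 0 < 2)%N) ?nnegrE ?(ltW r0) // real_normK ?num_real //.
apply: ltW; move: q0; rewrite subr_gt0; apply: le_lt_trans.
rewrite (bigD1 j) //= expr2 lerDl sumr_ge0 // => k _.
by rewrite -expr2 sqr_ge0.
Qed.

End FlatComp.

Section Frame.
Context {R : realType} {d : nat} {T : topologicalType} (A : atlas R d T).
Hypothesis hA : smooth_manifold A.

Lemma manifold_chart_img_open (c : idx A) (V : set T) : open V -> open (chart_img c V).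
Proof.
move=> oV; rewrite openE => _ [x [dx Vx] <-].
have imx : chart_img c setT (crd c x) by exists x.
have iV : \forall y \near crd c x, V (inv c y).
  apply: (manifold_inv_cont hA imx).
  by rewrite (manifold_crdK hA) //; apply: open_nbhs_nbhs.
have iD : \forall y \near crd c x, chart_img c setT y.
  by apply: open_nbhs_nbhs; split=> //; exact: (manifold_img_open hA).
rewrite /interior; near=> y.
have [x' [dx' _] yE] : chart_img c setT y by near: y.
exists x' => //; split=> //.
have : V (inv c y) by near: y.
by rewrite -yE (manifold_crdK hA).
Unshelve. all: by end_near. Qed.

Lemma manifold_smooth_atlas : smooth_atlas A.
Proof.
split; [exact: (manifold_cover hA)|exact: (manifold_crdK hA)| |].
  by move=> c c'; apply/manifold_chart_img_open/(manifold_dom_open hA).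
by move=> c c'; exact: (manifold_transition hA).
Qed.
Local Notation sA := manifold_smooth_atlas.

(** The set [S] is the image of a compact ball. The space being Hausdorff, [S] is closed in
    the whole manifold and not only in the chart domain; this makes extensions by zero
    smooth. *)
Lemma manifold_bump (x0 : T) (c : idx A) : dom c x0 ->
  exists (psi : 'rV[R]_d -> R) (S : set T), [/\ smooth_on setT psi, psi (crd c x0) != 0,
    closed S, S `<=` dom c & forall x, dom c x -> ~ S x -> psi (crd c x) = 0].
Proof.
move=> dx0; have oO : open (chart_img c setT) := @manifold_img_open _ _ _ _ hA c.
have : nbhs (crd c x0) (chart_img c setT).
  by apply: open_nbhs_nbhs; split=> //; exists x0.
move=> /nbhs_closedballP[r rO]; have [psi [spsi psi0 psir]] := smooth_bump (crd c x0) (gt0 r).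
pose B := closed_ball (crd c x0) r%:num.
have cB : compact B.
  apply: bounded_closed_compact; last exact: closed_ball_closed.
  rewrite /B closed_ballE //; exists (`|crd c x0| + r%:num); split; first exact: num_real.
  move=> M rM y /= yr; apply: (le_trans _ (ltW rM)).
  rewrite -[y](subKr (crd c x0)); apply: (le_trans (ler_normB _ _)).
  by rewrite lerD2l.
exists psi, (inv c @` B); split=> //.
- apply: compact_closed; first exact: (manifold_hausdorff hA).
  apply: continuous_compact cB; apply: continuous_in_subspaceT => y.
  by rewrite inE => /rO; exact: (manifold_inv_cont hA).
- by move=> _ [y /rO [x [dx _] <-] <-]; rewrite (manifold_crdK hA).
- move=> x dx; apply: contra_notP => /eqP/psir le_r.
  exists (crd c x); last exact: (manifold_crdK hA).
  by rewrite /B closed_ballE.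
Qed.

(** Multiply a field that is constant in a chart by a bump function and extend it by zero. *)
Lemma frame_field (x0 : T) (v : 'rV[R]_d) :
  exists2 X : T -> 'rV[R]_d, smooth_vfield A setT X & X x0 = v.
Proof.
pose c := chart_at A x0; have dx0 : dom c x0 := manifold_cover hA x0.
have [psi [S [spsi psi0 cS Sc psiS]]] := manifold_bump dx0.
pose X x := if `[< dom c x >] then
  psi (crd c x) *: (((psi (crd c x0))^-1 *: v) *m tjac c (chart_at A x) x) else 0.
exists X; last first.
  rewrite /X asboolT // tjac_id //; last exact: sA.
  by rewrite mulmx1 scalerA divff // scale1r.
have XE c' x : dom c x -> dom c' x ->
    X x *m tjac (chart_at A x) c' x = psi (crd c x) *: (((psi (crd c x0))^-1 *: v) *m tjac c c' x).
  move=> dx dx'; rewrite /X asboolT // -scalemxAl -mulmxA tjac_comp //; first exact: sA.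
  exact: (manifold_cover hA).
have X0 c' x : dom c' x -> ~ S x -> X x *m tjac (chart_at A x) c' x = 0.
  rewrite /X; case: asboolP => [dx dx' Sx|_ _ _]; last by rewrite mul0mx.
  by rewrite psiS // scale0r mul0mx.
move=> c'; apply: smooth_local => y /(chart_imgP sA)[dy' _ yE].
have [dy|ndy] := pselect (dom c (inv c' y)).
  (* On the overlap of the charts the field is given by a formula. *)
  exists (chart_img c' (dom c)); first exact/(chart_imgP sA).
  have oO := atlas_open sA c' c.
  apply: (smooth_eq (F := fun y => psi (crd c (inv c' y)) *:
     (((psi (crd c x0))^-1 *: v) *m tjac c c' (inv c' y)))) => //.
    move=> z; rewrite inE => /(chart_imgP sA)[dz dz' _].
    by rewrite /vcomp tcompE XE.
  apply/smooth_rV => // j.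
  apply: (smooth_eq (F := fun y => (psi \o (crd c \o @inv _ _ _ A c')) y *
     (((psi (crd c x0))^-1 *: v) *m tjac c c' (inv c' y)) 0 j)) => //.
    by move=> z _; rewrite [RHS]mxE.
  apply: smoothM => //.
    apply: (smooth_comp (B := setT)) => //; exact: (atlas_transition sA c' c).
  apply: smooth_mulmx => // [i k|i k]; first exact: smooth_cst.
  exact: (tjac_smooth_inv sA).
(* Off the closed support, hence near every point outside the chart, it vanishes. *)
exists (chart_img c' (~` S)).
  by apply/(chart_imgP sA); split=> // /Sc.
apply: (smooth_eq (F := fun=> 0)); last exact: smooth_cst.
  by apply/manifold_chart_img_open/closed_openC.
move=> z; rewrite inE => /(chart_imgP sA)[dz Sz _].
by rewrite /vcomp tcompE X0.
Qed.

End Frame.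

(** * Products of manifolds *)

Section Product.
Context {R : realType} {n m : nat} {T1 T2 : topologicalType}.
Context (A1 : atlas R n T1) (A2 : atlas R m T2).
Hypotheses (h1 : smooth_manifold A1) (h2 : smooth_manifold A2).

Lemma hausdorff_prod : hausdorff_space T1 -> hausdorff_space T2 ->
  hausdorff_space (T1 * T2)%type.
Proof.
move=> H1 H2 [p1 p2] [q1 q2] clpq; congr (_, _).
- apply: H1 => U V Up Vq.
  have Up' : nbhs (p1, p2) (fst @^-1` U) by exact: (@cvg_fst _ _ (nbhs p1) (nbhs p2) _ U Up).
  have Vq' : nbhs (q1, q2) (fst @^-1` V) by exact: (@cvg_fst _ _ (nbhs q1) (nbhs q2) _ V Vq).
  by have [x [Ux Vx]] := clpq _ _ Up' Vq'; exists x.1.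
- apply: H2 => U V Up Vq.
  have Up' : nbhs (p1, p2) (snd @^-1` U) by exact: (@cvg_snd _ _ (nbhs p1) (nbhs p2) _ U Up).
  have Vq' : nbhs (q1, q2) (snd @^-1` V) by exact: (@cvg_snd _ _ (nbhs q1) (nbhs q2) _ V Vq).
  by have [x [Ux Vx]] := clpq _ _ Up' Vq'; exists x.2.
Qed.

Lemma second_countable_prod : @second_countable T1 -> @second_countable T2 ->
  @second_countable (T1 * T2)%type.
Proof.
move=> [B1 cB1 [oB1 bB1]] [B2 cB2 [oB2 bB2]].
exists ((fun U : set T1 * set T2 => U.1 `*` U.2) @` (B1 `*` B2)).
  exact: (sub_countable (card_image_le _ _) (countableX cB1 cB2)).
have oX U V : open U -> open V -> open (U `*` V : set (T1 * T2)).
  move=> oU oV; have -> : U `*` V = (fst @^-1` U) `&` (snd @^-1` V :> set (T1 * T2)) by [].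
  by apply: openI; apply: open_comp => // x _; [exact: cvg_fst|exact: cvg_snd].
split=> [_ [[U V] [/= BU BV] <-]|x W].
  by apply: oX; [exact: oB1|exact: oB2].
move=> [[P Q] /= [Px Qx] PQW].
have [U [BU Ux] UP] := bB1 _ _ Px; have [V [BV Vx] VQ] := bB2 _ _ Qx.
exists (U `*` V); first by split => //; exists (U, V).
by move=> z [Uz Vz]; apply: PQW; split; [exact: UP|exact: VQ].
Qed.

Lemma prod_chart_img (c : idx (prod_atlas A1 A2)) (U1 : set T1) (U2 : set T2) :
  chart_img c (U1 `*` U2) =
  (@lsubmx R 1 n m @^-1` chart_img c.1 U1) `&` (@rsubmx R 1 n m @^-1` chart_img c.2 U2).
Proof.
apply/seteqP; split=> y.
  move=> [[x1 x2] [[/= d1 d2] [/= u1 u2]] <-]; split=> /=.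
    by rewrite row_mxKl; exists x1.
  by rewrite row_mxKr; exists x2.
move=> [[x1 [d1 u1] /= e1] [x2 [d2 u2] /= e2]].
by exists (x1, x2) => //=; rewrite e1 e2 hsubmxK.
Qed.

Lemma continuous_row_mx (T : topologicalType)
   (f : T -> 'rV[R]_n) (g : T -> 'rV[R]_m) (x : T) :
  {for x, continuous f} -> {for x, continuous g} ->
  {for x, continuous (fun y => row_mx (f y) (g y))}.
Proof.
move=> cf cg.
have cl (z : 'rV[R]_n) : {for z, continuous (fun y : 'rV[R]_n => row_mx y 0 : 'rV[R]_(n + m))}.
  apply: differentiable_continuous; apply: (smooth_diff (A := setT)) => //.
  apply: smooth_row_mx; [exact: openT| |exact: smooth_cst].
  apply/smooth_rV => [|j]; [exact: openT|apply: smooth_coord; exact: openT].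
have cr (z : 'rV[R]_m) : {for z, continuous (fun y : 'rV[R]_m => row_mx 0 y : 'rV[R]_(n + m))}.
  apply: differentiable_continuous; apply: (smooth_diff (A := setT)) => //.
  apply: smooth_row_mx; [exact: openT|exact: smooth_cst|].
  apply/smooth_rV => [|j]; [exact: openT|apply: smooth_coord; exact: openT].
have -> : (fun y => row_mx (f y) (g y)) =
    (fun y => row_mx (f y) (0 : 'rV[R]_m) + row_mx (0 : 'rV[R]_n) (g y)).
  by apply/funext => y; rewrite add_row_mx addr0 add0r.
apply: continuousD.
  exact: (continuous_comp cf (cl (f x))).
exact: (continuous_comp cg (cr (g x))).
Qed.

Lemma prod_manifold : smooth_manifold (prod_atlas A1 A2).
Proof.
have sT : [set: T1 * T2] = [set: T1] `*` [set: T2] by apply/seteqP; split.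
have pimg (c : idx (prod_atlas A1 A2)) : chart_img c setT =
    (@lsubmx R 1 n m @^-1` chart_img c.1 setT) `&` (@rsubmx R 1 n m @^-1` chart_img c.2 setT).
  by rewrite sT prod_chart_img.
have oprod (O1 : set 'rV[R]_n) (O2 : set 'rV[R]_m) : open O1 -> open O2 ->
    open ((@lsubmx R 1 n m @^-1` O1) `&` (@rsubmx R 1 n m @^-1` O2)).
  move=> o1 o2; apply: openI; apply: open_comp => // x _.
    exact: continuous_lsubmx.
  exact: continuous_rsubmx.
split.
- have [x1 _] := manifold_nonempty h1; have [x2 _] := manifold_nonempty h2.
  by exists (x1, x2).
- by apply: hausdorff_prod; [exact: (manifold_hausdorff h1)|exact: (manifold_hausdorff h2)].
- apply: second_countable_prod; [exact: (manifold_second_countable h1)|].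
  exact: (manifold_second_countable h2).
- by move=> x; split; [exact: (manifold_cover h1)|exact: (manifold_cover h2)].
- move=> c.
  have -> : dom c = (fst @^-1` dom c.1) `&` (snd @^-1` dom c.2 :> set (T1 * T2)) by [].
  apply: openI.
  + by apply: open_comp (manifold_dom_open h1 _) => x _; exact: cvg_fst.
  + by apply: open_comp (manifold_dom_open h2 _) => x _; exact: cvg_snd.
- move=> c; rewrite pimg; apply: oprod; [exact: (manifold_img_open h1)|].
  exact: (manifold_img_open h2).
- move=> c [x1 x2] [/= d1 d2]; rewrite row_mxKl row_mxKr.
  by rewrite (manifold_crdK h1) // (manifold_crdK h2).
- move=> c x [d1 d2]; apply: continuous_row_mx.
  + exact: (continuous_comp (@cvg_fst _ _ (nbhs x.1) (nbhs x.2) _ : {for x, continuous fst})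
      (manifold_crd_cont h1 d1)).
  + exact: (continuous_comp (@cvg_snd _ _ (nbhs x.1) (nbhs x.2) _ : {for x, continuous snd})
      (manifold_crd_cont h2 d2)).
- move=> c y; rewrite pimg => -[/= i1 i2].
  have c1 := continuous_comp
    (@continuous_lsubmx R 1 n m y : {for y, continuous lsubmx}) (manifold_inv_cont h1 i1).
  have c2 := continuous_comp
    (@continuous_rsubmx R 1 n m y : {for y, continuous rsubmx}) (manifold_inv_cont h2 i2).
  exact: (cvg_pair c1 c2).
- move=> c c'.
  have s1 := manifold_smooth_atlas h1; have s2 := manifold_smooth_atlas h2.
  have o1 := atlas_open s1 c.1 c'.1; have o2 := atlas_open s2 c.2 c'.2.
  have -> : dom c' = dom c'.1 `*` dom c'.2 by [].
  rewrite prod_chart_img; set O := _ `&` _.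
  have oO : open O by exact: oprod.
  apply: smooth_row_mx => //.
  + apply: (smooth_compV (B := chart_img c.1 (dom c'.1))
      (F := crd c'.1 \o @inv _ _ _ A1 c.1) (Phi := @lsubmx R 1 n m)) => //.
    * by move=> y [].
    * exact: (atlas_transition s1).
    * exact: smooth_lsubmx.
  + apply: (smooth_compV (B := chart_img c.2 (dom c'.2))
      (F := crd c'.2 \o @inv _ _ _ A2 c.2) (Phi := @rsubmx R 1 n m)) => //.
    * by move=> y [].
    * exact: (atlas_transition s2).
    * exact: smooth_rsubmx.
Qed.

End Product.

(** * The Sasaki metric in one chart *)

Lemma diff_near (R : realType) (V W : normedModType R) (f g : V -> W) x v :
  {near x, f =1 g} -> differentiable g x -> 'd f x v = 'D_v g x.
Proof.
move=> fg dg.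
have gf : {near x, g =1 f} by apply: filterS fg => y ->.
rewrite -deriveE; last exact: near_eq_differentiable gf dg.
exact: near_eq_derive.
Qed.

Lemma diff_coordB (R : realType) (W : normedModType R) (e : nat) (F G : W -> 'rV[R]_e)
    (x v v' : W) (j : 'I_e) : differentiable F x -> differentiable G x ->
  ('d F x v - 'd G x v') 0 j =
    'D_v (fun y => F y 0 j) x - 'D_v' (fun y => G y 0 j) x.
Proof.
move=> dF dG; rewrite [LHS]mxE [X in _ + X = _]mxE.
by rewrite -(derive_rV _ _ dF) -(derive_rV _ _ dG) (deriveE _ dF) (deriveE _ dG).
Qed.

(** Differentiability is proved along the way because [vderive] is a differential. *)
Lemma derive_bilinear (R : realType) (n : nat) (W : normedModType R)
    (g : 'I_n -> 'I_n -> W -> R) (x y : 'I_n -> W -> R) (w v : W) :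
  (forall a b, differentiable (g a b) w) ->
  (forall a, differentiable (x a) w) -> (forall a, differentiable (y a) w) ->
  differentiable (fun w => \sum_a \sum_b g a b w * x a w * y b w) w /\
  'D_v (fun w => \sum_a \sum_b g a b w * x a w * y b w) w =
  \sum_a \sum_b 'D_v (g a b) w * x a w * y b w +
  \sum_a \sum_b g a b w * 'D_v (x a) w * y b w +
  \sum_a \sum_b g a b w * x a w * 'D_v (y b) w.
Proof.
move=> dg dx dy.
have -> : (fun w => \sum_a \sum_b g a b w * x a w * y b w) =
    \sum_(a < n) \sum_(b < n) (g a b * x a * y b).
  by apply/funext => z; rewrite fct_sumE; apply: eq_bigr => a _; rewrite fct_sumE.
have dt a b : differentiable (g a b * x a * y b) w.
  by apply: differentiableM => //; apply: differentiableM.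
have ds a : differentiable (\sum_(b < n) g a b * x a * y b) w by exact: differentiable_sum.
split; first exact: differentiable_sum.
rewrite derive_sum => [|a]; last exact: diff_derivable.
rewrite -!big_split /=; apply: eq_bigr => a _.
rewrite derive_sum => [|b]; last exact: diff_derivable.
rewrite -!big_split /=; apply: eq_bigr => b _.
have gd := diff_derivable (v := v) (dg a b).
have xd := diff_derivable (v := v) (dx a); have yd := diff_derivable (v := v) (dy b).
rewrite [LHS](deriveM (derivableM gd xd) yd) (deriveM gd xd) /GRing.scale /=.
by rewrite mulrfctE; ring.
Qed.

Section LocalSasaki.
Context {R : realType} {n : nat}.
Variables (K : 'rV[R]_(n + n) -> R) (O : set 'rV[R]_(n + n)).
Hypotheses (oO : open O) (sK : smooth_on O K).
Hypothesis uK : forall w, O w -> gup K w \in unitmx.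
Hypothesis symK : forall w, O w -> (gup K w)^T = gup K w.

Lemma gup_smooth a b : smooth_on O (fun w => gup K w a b).
Proof.
apply: (smooth_eq (F := fun w => 2^-1 * dp a (dp b K) w)) => //.
  by move=> w _; rewrite /gup !mxE.
by apply: smoothM => //; [exact: smooth_cst|exact/smooth_partial/smooth_partial].
Qed.

Lemma glow_smooth a b : smooth_on O (fun w => glow K w a b).
Proof. exact: (smooth_invmx oO uK gup_smooth). Qed.

Lemma glow_sym w : O w -> (glow K w)^T = glow K w.
Proof. by move=> Ow; rewrite /glow trmx_inv symK. Qed.

Lemma nonlinear_connection_smooth a b :
  smooth_on O (fun w => nonlinear_connection K w a b).
Proof.
apply: (smooth_eq (F := fun w =>
  (4^-1 * poisson (fun w' => glow K w' a b) K w
   - 4^-1 * \sum_(c < n) (glow K w a c * dp c (dx b K) w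
                          + glow K w b c * dp c (dx a K) w)))) => //.
  by move=> w _; rewrite mxE.
apply: smoothB => //; apply: smoothM => //; try exact: smooth_cst.
  apply: smooth_sum => // c; apply: smoothB => //; apply: smoothM => //;
    by apply: smooth_partial => //; exact: glow_smooth.
apply: smooth_sum => // c; apply: smoothD => //; apply: smoothM => //;
  by [exact: glow_smooth|exact/smooth_partial/smooth_partial].
Qed.

Lemma nonlinear_connection_sym w : O w ->
  (nonlinear_connection K w)^T = nonlinear_connection K w.
Proof.
move=> Ow; apply/matrixP => a b; rewrite [LHS]mxE [LHS]mxE [RHS]mxE.
have E : {near w, (fun w' => glow K w' b a) =1 (fun w' => glow K w' a b)}.
  apply: (open_near_eq oO) => // w'; rewrite inE => /glow_sym {1}<-.
  by rewrite mxE.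
apply: (congr2 (fun p q => 4^-1 * p - 4^-1 * q)).
  apply: eq_bigr => c _; rewrite /dp /dx.
  by rewrite (near_eq_derive _ E) [X in _ - _ * X](near_eq_derive _ E).
by apply: eq_bigr => c _; exact: addrC.
Qed.

Lemma local_sasakiE w v v' : local_sasaki K w v v' =
  (lsubmx v *m glow K w *m (lsubmx v')^T) 0 0 +
  (delta_p K w v *m gup K w *m (delta_p K w v')^T) 0 0.
Proof.
have E (g : 'M[R]_n) (x y : 'rV[R]_n) :
    (x *m g *m y^T) 0 0 = \sum_a \sum_b g a b * x 0 a * y 0 b.
  rewrite mxE exchange_big; apply: eq_bigr => b _; rewrite !mxE mulr_suml.
  by apply: eq_bigr => a _; rewrite [x 0 a * _]mulrC.
by rewrite /local_sasaki !E.
Qed.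

Lemma delta_pD w v v' : delta_p K w (v + v') = delta_p K w v + delta_p K w v'.
Proof. by rewrite /delta_p !linearD /= mulmxDl addrACA -opprD. Qed.

Lemma local_sasakiDl w v1 v2 v' :
  local_sasaki K w (v1 + v2) v' = local_sasaki K w v1 v' + local_sasaki K w v2 v'.
Proof.
have mxD (x y : 'M[R]_1) : (x + y) 0 0 = x 0 0 + y 0 0 by rewrite mxE.
by rewrite !local_sasakiE delta_pD linearD /= !mulmxDl !mxD addrACA.
Qed.

Lemma local_sasakiC w v v' : O w -> local_sasaki K w v v' = local_sasaki K w v' v.
Proof.
move=> Ow; rewrite !local_sasakiE.
have E (g : 'M[R]_n) (x y : 'rV[R]_n) : g^T = g -> (x *m g *m y^T) 0 0 = (y *m g *m x^T) 0 0.
  move=> gs; transitivity ((x *m g *m y^T)^T 0 0); first by rewrite [RHS]mxE.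
  by rewrite !trmx_mul trmxK gs mulmxA.
by rewrite (E _ _ _ (glow_sym Ow)) (E _ _ _ (symK Ow)).
Qed.

Lemma delta_starP w v : O w ->
  (v <= delta_star K w)%MS <-> delta_p K w v = 0.
Proof.
move=> Ow; rewrite /delta_p nonlinear_connection_sym //; split.
  move=> /submxP[x ->]; rewrite mul_mx_row row_mxKl row_mxKr mulmx1.
  by rewrite subrr.
move=> /subr0_eq vE; apply/submxP; exists (lsubmx v).
by rewrite mul_mx_row mulmx1 -vE hsubmxK.
Qed.

Lemma local_sasaki_horizontal w v v' : delta_p K w v = 0 ->
  local_sasaki K w v v' = (lsubmx v *m glow K w *m (lsubmx v')^T) 0 0.
Proof. by move=> dv; rewrite local_sasakiE dv !mul0mx [X in _ + X]mxE addr0. Qed.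

Lemma delta_p_vertical w v : lsubmx v = 0 -> delta_p K w v = rsubmx v.
Proof. by move=> lv; rewrite /delta_p lv mul0mx subr0. Qed.

(** Against the vertical vector dual to q_b only the second term of the metric survives,
    and g^ab is invertible: the horizontal space is the orthogonal complement of the
    vertical one. *)
Lemma delta_p_orthogonal w v : O w ->
  (forall v', lsubmx v' = 0 -> local_sasaki K w v v' = 0) -> delta_p K w v = 0.
Proof.
move=> Ow vo; suff : delta_p K w v *m gup K w = 0.
  by move=> /(congr1 (mulmx^~ (invmx (gup K w)))); rewrite mul0mx mulmxK ?uK.
apply/rowP => j; pose e : 'rV[R]_(n + n) := row_mx 0 (delta_mx 0 j).
have le : lsubmx e = 0 by exact: row_mxKl.
have := vo e le; rewrite local_sasakiE (delta_p_vertical _ le) le.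
rewrite [rsubmx e]row_mxKr trmx0 mulmx0 [X in X + _]mxE add0r trmx_delta -colE mxE => ->.
by rewrite mxE.
Qed.

End LocalSasaki.

(** * Koszul's formula and the bundle-like condition *)

Section Koszul.
Context {R : realType} {d : nat} {V : Type} (B : atlas R d V).
Variables (U : set V) (G : V -> 'rV[R]_d -> 'rV[R]_d -> R).
Variable (nabla : (V -> 'rV[R]_d) -> (V -> 'rV[R]_d) -> V -> 'rV[R]_d).
Hypothesis hnabla : levi_civita B U G nabla.

(** Metric compatibility is used for the three pairs of fields; the vanishing of the torsion
    turns the derivatives of Z along X and Y into derivatives along Z and brackets. *)
Lemma koszul X Y Z u : U u ->
  (forall v1 v2 v, G u (v1 + v2) v = G u v1 v + G u v2 v) ->
  (forall v1 v2, G u v1 v2 = G u v2 v1) ->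
  smooth_vfield B U X -> smooth_vfield B U Y -> smooth_vfield B U Z ->
  G u (nabla X Y u + nabla Y X u) (Z u) =
    vderive B X (fun v => G v (Y v) (Z v)) u + vderive B Y (fun v => G v (X v) (Z v)) u
    - vderive B Z (fun v => G v (X v) (Y v)) u
    - G u (Y u) (lie_bracket B X Z u) - G u (X u) (lie_bracket B Y Z u).
Proof.
move=> Uu GD GC sX sY sZ; have [_ tors metr] := hnabla.
have Uin : u \in U by rewrite inE.
have GB v v1 v2 : G u v (v1 - v2) = G u v v1 - G u v v2.
  by have := GD (v1 - v2) v2 v; rewrite subrK !(GC v) => ->; rewrite addrK.
rewrite !metr // -!tors // GD !GB.
rewrite [G u (nabla Z X u) _]GC.
by ring.
Qed.

End Koszul.

(** What follows only uses that changes of charts preserve the vertical directions and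
    that [G] has its local form in every chart; the cotangent bundle is an instance. *)
Section PhaseSpace.
Context {R : realType} {n : nat} {V : Type} (B : atlas R (n + n) V).
Variables (U : set V) (K : V -> R) (G : V -> 'rV[R]_(n + n) -> 'rV[R]_(n + n) -> R).
Local Notation Kc c := (K \o @inv _ _ _ B c).
Hypothesis sB : smooth_atlas B.
Hypothesis oU : forall c : idx B, open (chart_img c U).
Hypothesis sK : smooth_fun B U K.
Hypothesis uK : forall (c : idx B) w, chart_img c U w -> gup (Kc c) w \in unitmx.
Hypothesis symK : forall (c : idx B) w, chart_img c U w -> (gup (Kc c) w)^T = gup (Kc c) w.
Hypothesis lsub_tjac : forall (c c' : idx B) u (v : 'rV[R]_(n + n)), dom c u -> dom c' u ->
  lsubmx v = 0 -> lsubmx (v *m tjac c c' u) = 0.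
Hypothesis hG : forall (c : idx B) u v v', dom c u -> U u ->
  G u v v' = local_sasaki (Kc c) (crd c u) (tcomp c u v) (tcomp c u v').

Definition horizontal_field (X : V -> 'rV[R]_(n + n)) := smooth_vfield B U X /\
  forall (c : idx B) u, dom c u -> U u -> (tcomp c u (X u) <= delta_star (Kc c) (crd c u))%MS.

Definition vertical_field (X : V -> 'rV[R]_(n + n)) := smooth_vfield B U X /\
  forall (c : idx B) u, dom c u -> U u -> lsubmx (tcomp c u (X u)) = 0.

Let sKc (c : idx B) : smooth_on (chart_img c U) (Kc c). Proof. exact: sK. Qed.

Let hP (c : idx B) w v : chart_img c U w ->
  (v <= delta_star (Kc c) w)%MS <-> delta_p (Kc c) w v = 0.
Proof. by move=> Ow; apply: (delta_starP (@oU c) (symK (c := c))). Qed.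

(** Horizontality can be read in any chart. Instead of the transformation law of the
    connection coefficients, this uses that [G] has its local form in every chart and
    that a vector is horizontal exactly when it is [G]-orthogonal to the vertical ones. *)
Lemma horizontal_chart (c c' : idx B) u (v : 'rV[R]_(n + n)) : dom c u -> dom c' u -> U u ->
  (tcomp c u v <= delta_star (Kc c) (crd c u))%MS ->
  (tcomp c' u v <= delta_star (Kc c') (crd c' u))%MS.
Proof.
move=> du du' Uu.
have Ow : chart_img c U (crd c u) by exact: chart_img_crd.
have Ow' : chart_img c' U (crd c' u) by exact: chart_img_crd.
have d0 := atlas_cover sB u.
move=> /(hP _ Ow) hv.
apply/(hP _ Ow').
apply: (delta_p_orthogonal (uK (c := c')) Ow') => v' lv'.
pose z := v' *m tjac c' (chart_at B u) u.
have -> : v' = tcomp c' u z by rewrite tcompE /z -mulmxA tjacK // mulmx1.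
rewrite -hG // (hG (c := c)) // local_sasaki_horizontal //.
by rewrite [tcomp c u z]tcompE lsub_tjac ?trmx0 ?mulmx0 ?mxE // /z lsub_tjac.
Qed.

(** The hypothesis on [xi] says that it is a smooth field of base components. The lift is
    defined in the chart selected at each point; in another chart it is the horizontal
    vector with the same base part, hence smooth because the connection is. *)
Lemma horizontal_lift (xi : V -> 'rV[R]_n) :
  (forall c : idx B, smooth_on (chart_img c U)
     (fun w => lsubmx (vcomp (fun u => row_mx (xi u) 0) c w))) ->
  horizontal_field (fun u => xi u *m delta_star (Kc (chart_at B u)) (crd (chart_at B u) u)).
Proof.
move=> sxi; set X := (fun u => _).
have hX (c : idx B) u : dom c u -> U u -> (tcomp c u (X u) <= delta_star (Kc c) (crd c u))%MS.
  move=> du Uu; apply: (horizontal_chart (c := chart_at B u)) => //; first exact: (atlas_cover sB).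
  by rewrite tcomp_chart_at // submxMl.
split=> // c.
apply: (smooth_eq (F := fun w => lsubmx (vcomp (fun u => row_mx (xi u) 0) c w) *m
    delta_star (Kc c) w)) => //.
  move=> w; rewrite inE => /(chart_imgP sB)[dw Uw wE].
  rewrite [RHS]/vcomp; set u := inv c w in dw Uw wE *.
  have := hX c u dw Uw; rewrite wE => /submxP[x xE]; rewrite xE; congr (_ *m _).
  have d0 := atlas_cover sB u.
  transitivity (lsubmx (tcomp c u (X u))).
    apply/subr0_eq; rewrite -linearB /= /vcomp -/u !tcompE -mulmxBl lsub_tjac //.
    by rewrite linearB /= row_mxKl /X mul_mx_row row_mxKl mulmx1 subrr.
  by rewrite xE mul_mx_row row_mxKl mulmx1.
apply: smooth_rowmul => // i j.
rewrite /delta_star; case: (splitP j) => k jk.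
  have -> : j = lshift n k by apply: val_inj.
  apply: (smooth_eq (F := fun=> (1%:M : 'M[R]_n) i k)) => //; last exact: smooth_cst.
  by move=> w _; rewrite row_mxEl.
have -> : j = rshift n k by apply: val_inj.
apply: (smooth_eq (F := fun w => nonlinear_connection (Kc c) w i k)) => //.
  by move=> w _; rewrite row_mxEr.
exact: (nonlinear_connection_smooth (@oU c) (@sKc c) (uK (c := c))).
Qed.

Lemma lie_bracket_coord X Y u (j : 'I_(n + n)) : U u ->
  smooth_vfield B U X -> smooth_vfield B U Y ->
  lie_bracket B X Y u 0 j =
    'D_(X u) (fun w => vcomp Y (chart_at B u) w 0 j) (crd (chart_at B u) u)
    - 'D_(Y u) (fun w => vcomp X (chart_at B u) w 0 j) (crd (chart_at B u) u).
Proof.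
move=> Uu sX sY; rewrite /lie_bracket.
have Ow : chart_img (chart_at B u) U (crd (chart_at B u) u).
  by apply: chart_img_crd => //; exact: (atlas_cover sB).
have dX := smooth_diff (sX _) Ow; have dY := smooth_diff (sY _) Ow.
exact: diff_coordB.
Qed.

Lemma sasakiC u v v' : U u -> G u v v' = G u v' v.
Proof.
move=> Uu; have d0 := atlas_cover sB u.
by rewrite !(hG (c := chart_at B u)) // (local_sasakiC (symK (c := _))) //; exact: chart_img_crd.
Qed.

Lemma sasakiDl u v1 v2 v : U u -> G u (v1 + v2) v = G u v1 v + G u v2 v.
Proof.
move=> Uu; have d0 := atlas_cover sB u.
by rewrite !(hG (c := chart_at B u)) // !tcompE mulmxDl local_sasakiDl.
Qed.

Lemma sasaki_hv X Z u : U u -> horizontal_field X -> vertical_field Z -> G u (X u) (Z u) = 0.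
Proof.
move=> Uu [_ hX] [_ vZ]; have d0 := atlas_cover sB u.
have Ow : chart_img (chart_at B u) U (crd (chart_at B u) u) by exact: chart_img_crd.
rewrite (hG (c := chart_at B u)) // local_sasaki_horizontal.
  by rewrite vZ // trmx0 mulmx0 mxE.
exact/(hP _ Ow)/hX.
Qed.

Lemma sasaki_horizontalE (X : V -> 'rV[R]_(n + n)) (c : idx B) u v :
  dom c u -> U u -> horizontal_field X ->
  G u (X u) v = \sum_a \sum_b
    glow (Kc c) (crd c u) a b * tcomp c u (X u) 0 (lshift n a) * tcomp c u v 0 (lshift n b).
Proof.
move=> du Uu [_ hX].
have Ow : chart_img c U (crd c u) by exact: chart_img_crd.
have /(hP _ Ow) := hX c u du Uu.
rewrite (hG (c := c)) // => hX0.
rewrite local_sasaki_horizontal // mxE exchange_big; apply: eq_bigr => b _.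
by rewrite !mxE mulr_suml; apply: eq_bigr => a _; rewrite mxE [X in X * _]mulrC.
Qed.

(** The left-hand side is minus the Lie derivative of [G] along Z, evaluated at X and Y.
    Horizontal and vertical fields being orthogonal, only Z(G(X, Y)) and the two brackets
    remain in Koszul's formula; the base components of [X, Z] are minus the derivatives
    of those of X along Z, which cancels all terms except the derivative of g_ab. *)
Lemma bundle_like_defect nabla X Y Z u (c := chart_at B u) : levi_civita B U G nabla ->
  U u -> horizontal_field X -> horizontal_field Y -> vertical_field Z ->
  G u (nabla X Y u + nabla Y X u) (Z u) = - \sum_a \sum_b
    'D_(Z u) (fun w => glow (Kc c) w a b) (crd c u) *
      X u 0 (lshift n a) * Y u 0 (lshift n b).
Proof.
move=> hn Uu hX hY vZ; have d0 := atlas_cover sB u.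
have [sX _] := hX; have [sY _] := hY; have [sZ _] := vZ.
set w0 := crd c u.
have Ow : chart_img c U w0 by exact: chart_img_crd.
have nO : \forall w \near w0, chart_img c U w by exact: open_nbhs_nbhs.
have vE (F : V -> 'rV[R]_(n + n)) : vcomp F c w0 = F u.
  by rewrite /vcomp /w0 (atlas_crdK sB) // tcomp_chart_at.
have vd0 F H : horizontal_field F -> smooth_vfield B U H ->
    vderive B H (fun v => G v (F v) (Z v)) u = 0.
  move=> hF sH; rewrite /vderive (diff_near (g := cst 0)) ?derive_cst //.
  by apply: filterS nO => w /(chart_imgP sB)[dw Uw _] /=; rewrite sasaki_hv.
pose x a w := vcomp X c w 0 (lshift n a); pose y a w := vcomp Y c w 0 (lshift n a).
pose g a b w := glow (Kc c) w a b.
have dx a : differentiable (x a) w0 by apply/(differentiable_rV _ _).1/(smooth_diff (sX c)).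
have dy a : differentiable (y a) w0 by apply/(differentiable_rV _ _).1/(smooth_diff (sY c)).
have dg a b : differentiable (g a b) w0.
  exact: (smooth_diff (glow_smooth (@oU c) (@sKc c) (uK (c := c)) a b)).
have [dxy Dxy] := derive_bilinear (Z u) dg dx dy.
have formE w : chart_img c U w -> G (inv c w) (X (inv c w)) (Y (inv c w)) =
    \sum_a \sum_b g a b w * x a w * y b w.
  move=> /(chart_imgP sB)[dw Uw wE].
  have := sasaki_horizontalE (Y (inv c w)) dw Uw hX; rewrite wE => ->.
  by [].
have -> : G u (nabla X Y u + nabla Y X u) (Z u) =
    - ('D_(Z u) (fun w => \sum_a \sum_b g a b w * x a w * y b w) w0)
    - G u (lie_bracket B X Z u) (Y u) - G u (X u) (lie_bracket B Y Z u).
  rewrite (koszul hn) //.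
  - rewrite !vd0 // add0r [G u (lie_bracket _ _ _ _) _]sasakiC //.
    congr (_ - _ - _); rewrite sub0r; congr (- _).
    apply: diff_near => //; near=> w.
    by apply: formE; near: w.
  - by move=> *; rewrite sasakiDl.
  - by move=> *; rewrite sasakiC.
have lieE F a : smooth_vfield B U F -> lie_bracket B F Z u 0 (lshift n a) =
    - 'D_(Z u) (fun w => vcomp F c w 0 (lshift n a)) w0.
  move=> sF; rewrite lie_bracket_coord // -/c -/w0.
  rewrite (near_eq_derive _ (g := cst 0)) ?derive_cst ?sub0r //.
  near=> w; have /(chart_imgP sB)[dw Uw wE] : chart_img c U w by near: w.
  have lz (v : 'rV[R]_(n + n)) : lsubmx v = 0 -> v 0 (lshift n a) = 0.
    by move=> /rowP/(_ a); rewrite !mxE.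
  exact: lz (vZ.2 c _ dw Uw).
have tc v : tcomp c u v = v by exact: (tcomp_chart_at sB).
have ex a : x a w0 = X u 0 (lshift n a) by rewrite /x vE.
have ey a : y a w0 = Y u 0 (lshift n a) by rewrite /y vE.
have GY v : G u v (Y u) = \sum_a \sum_b g a b w0 * v 0 (lshift n a) * y b w0.
  rewrite sasakiC // (sasaki_horizontalE v d0 Uu hY) !tc exchange_big.
  apply: eq_bigr => a _; apply: eq_bigr => b _; rewrite ey.
  have gs : glow (Kc c) w0 b a = g a b w0.
    by rewrite /g -[in RHS](glow_sym (symK (c := c)) Ow) mxE.
  by rewrite -/c -/w0 gs mulrAC.
have GX v : G u (X u) v = \sum_a \sum_b g a b w0 * x a w0 * v 0 (lshift n b).
  rewrite (sasaki_horizontalE v d0 Uu hX) !tc.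
  by apply: eq_bigr => a _; apply: eq_bigr => b _; rewrite ex.
rewrite GX GY Dxy.
have -> : \sum_a \sum_b g a b w0 * lie_bracket B X Z u 0 (lshift n a) * y b w0 =
    - \sum_a \sum_b g a b w0 * 'D_(Z u) (x a) w0 * y b w0.
  rewrite -sumrN; apply: eq_bigr => a _; rewrite -sumrN; apply: eq_bigr => b _.
  by rewrite (lieE _ _ sX) mulrN mulNr.
have -> : \sum_a \sum_b g a b w0 * x a w0 * lie_bracket B Y Z u 0 (lshift n b) =
    - \sum_a \sum_b g a b w0 * x a w0 * 'D_(Z u) (y b) w0.
  rewrite -sumrN; apply: eq_bigr => a _; rewrite -sumrN; apply: eq_bigr => b _.
  by rewrite (lieE _ _ sY) mulrN.
rewrite !opprK -!addrA opprD -!addrA opprD.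
transitivity (- \sum_a \sum_b 'D_(Z u) (g a b) w0 * x a w0 * y b w0).
  set S1 := \sum_a _; set S2 := \sum_a _; set S3 := \sum_a _.
  by rewrite -opprD addNr addr0.
congr (- _); apply: eq_bigr => a _; apply: eq_bigr => b _; by rewrite ex ey.
Unshelve. all: by end_near. Qed.

End PhaseSpace.

Section BundleLike.
Context {R : realType} {n : nat} {T : topologicalType} (A : atlas R n T).
Variables (K : T * 'rV[R]_n -> R) (U : set (T * 'rV[R]_n)).
Variable G : T * 'rV[R]_n -> 'rV[R]_(n + n) -> 'rV[R]_(n + n) -> R.
Variable nabla : (T * 'rV[R]_n -> 'rV[R]_(n + n)) ->
  (T * 'rV[R]_n -> 'rV[R]_(n + n)) -> T * 'rV[R]_n -> 'rV[R]_(n + n).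
Local Notation CA := (cotangent A).
Hypothesis hA : smooth_manifold A.
Hypothesis oU : forall c : idx A, open (chart_img (A := CA) c U).
Hypothesis sK : smooth_fun CA U K.
Hypothesis uK : forall (c : idx A) w, chart_img (A := CA) c U w -> gup (lexpr K c) w \in unitmx.
Hypothesis symK : forall (c : idx A) w, chart_img (A := CA) c U w ->
  (gup (lexpr K c) w)^T = gup (lexpr K c) w.
Hypothesis hG : sasaki_metric A K U G.
Hypothesis hnabla : levi_civita CA U G nabla.

Let sA : smooth_atlas A. Proof. exact: manifold_smooth_atlas. Qed.
Let sCA : smooth_atlas CA. Proof. exact: cot_smooth_atlas. Qed.

Lemma cot_lsub_tjac (c c' : idx CA) u (v : 'rV[R]_(n + n)) : dom c u -> dom c' u ->
  lsubmx v = 0 -> lsubmx (v *m tjac c c' u) = 0.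
Proof. by move=> du du' lv; rewrite (lsubmx_tjac sA) // lv mul0mx. Qed.

Lemma verticalP X : vertical A U X <-> vertical_field CA U X.
Proof.
have dl w v : 'd (@lsubmx R 1 n n) w v = lsubmx v.
  by rewrite diff_lin //; exact: continuous_lsubmx.
split=> -[sX vX]; split=> // c u du Uu; have := vX c u du Uu; by rewrite dl.
Qed.

Lemma bundle_like_defect_cot X Y Z u (c := chart_at A u.1) : U u ->
  horizontal A K U X -> horizontal A K U Y -> vertical A U Z ->
  G u (nabla X Y u + nabla Y X u) (Z u) = - \sum_a \sum_b
    'D_(Z u) (fun w => glow (lexpr K c) w a b) (crd (a := CA) c u) *
      X u 0 (lshift n a) * Y u 0 (lshift n b).
Proof.
move=> Uu hX hY /verticalP vZ.
exact: (bundle_like_defect (B := CA) sCA oU sK uK symK hG hnabla Uu hX hY vZ).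
Qed.

Lemma bundle_like_of_derive0 :
  (forall (c : idx A) w z a b, chart_img (A := CA) c U w -> lsubmx z = 0 ->
     'D_z (fun w => glow (lexpr K c) w a b) w = 0) ->
  bundle_like A K U G nabla.
Proof.
move=> D0 X Y Z hX hY vZ u; rewrite inE => Uu; rewrite bundle_like_defect_cot //.
rewrite big1 ?oppr0 // => a _; rewrite big1 // => b _.
have d0 : dom (a := CA) (chart_at A u.1) u by exact: (atlas_cover sA).
rewrite D0 ?mul0r //; first exact: chart_img_crd.
have /verticalP[_ /(_ _ _ d0 Uu)] := vZ.
by rewrite (tcomp_chart_at sCA).
Qed.

(** Components in the chart selected at the base point, whose momenta are [u.2] itself. *)
Definition liouville (u : T * 'rV[R]_n) : 'rV[R]_(n + n) := row_mx 0 u.2.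

Lemma cot_momentum_chart_at (u : T * 'rV[R]_n) :
  crd (a := CA) (chart_at A u.1) u = row_mx (crd (chart_at A u.1) u.1) u.2.
Proof.
by rewrite cot_crdE (tjac_id sA) ?trmx1 ?mulmx1 //; exact: (atlas_cover sA).
Qed.

Lemma tcomp_liouville (c : idx A) u : dom c u.1 ->
  tcomp (A := CA) c u (liouville u) = row_mx 0 (rsubmx (crd (a := CA) c u)).
Proof.
move=> du; rewrite tcompE; have d0 := atlas_cover sA u.1.
rewrite -(liouville_tjac sA d0 du); congr (_ *m _); rewrite /liouville.
have -> // : rsubmx (crd (a := CA) (chart_at A u.1) u) = u.2.
by rewrite cot_momentum_chart_at row_mxKr.
Qed.

Lemma vertical_liouville : vertical A U liouville.
Proof.
apply/verticalP; split=> c.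
  apply: (smooth_eq (F := fun w => row_mx (0 : 'rV[R]_n) (rsubmx w))) => //.
    move=> w; rewrite inE => /(chart_imgP sCA)[dw _ wE].
    by rewrite /vcomp tcomp_liouville // wE.
  by apply: smooth_row_mx => //; [exact: smooth_cst|exact: smooth_rsubmx].
by move=> u du Uu; rewrite tcomp_liouville // row_mxKl.
Qed.

(** Lift a field of the base: its base components are then prescribed on the whole fibre. *)
Lemma horizontal_extension (x : T) (v : 'rV[R]_n) :
  exists2 X, horizontal A K U X & forall p, lsubmx (X (x, p)) = v.
Proof.
have [xi sxi xiE] := frame_field hA x v.
pose Xi u := xi u.1 *m delta_star (K \o @inv _ _ _ CA (chart_at CA u)) (crd (chart_at CA u) u).
exists Xi; last first.
  by move=> p; rewrite /Xi /delta_star mul_mx_row row_mxKl mulmx1.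
apply: (horizontal_lift (B := CA) sCA oU sK uK symK cot_lsub_tjac hG
  (xi := fun u => xi u.1)) => c; change (idx A) in c.
apply: (smooth_eq (F := vcomp xi c \o @lsubmx R 1 n n)) => //.
  move=> w; rewrite inE => /(chart_imgP sCA)[dw _ wE].
  rewrite /vcomp tcompE (lsubmx_tjac sA) //; last exact: (atlas_cover sA).
  by rewrite row_mxKl /= tcompE.
apply: (smooth_compV (B := chart_img c setT) (F := vcomp xi c) (Phi := @lsubmx R 1 n n)) => //.
- exact: (chart_img_open_total sA).
- by move=> w /(cot_chart_imgP sA)[].
- exact: smooth_lsubmx.
Qed.

(** Test the bundle-like condition on the Liouville field and on horizontal fields whose
    base components at the point are unit vectors. *)
Lemma liouville_derive0 : bundle_like A K U G nabla ->
  forall u a b (c := chart_at A u.1), U u ->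
  'D_(row_mx 0 u.2) (fun w => glow (lexpr K c) w a b) (row_mx (crd c u.1) u.2) = 0.
Proof.
move=> bl u a b c Uu.
have [X hX XE] := horizontal_extension u.1 (delta_mx 0 a).
have [Y hY YE] := horizontal_extension u.1 (delta_mx 0 b).
have Uin : u \in U by rewrite inE.
have := bl X Y _ hX hY vertical_liouville u Uin.
rewrite bundle_like_defect_cot // ?cot_momentum_chart_at; last exact: vertical_liouville.
have XuE i : X u 0 (lshift n i) = (i == a)%:R.
  by have /rowP/(_ i) := XE u.2; rewrite -surjective_pairing !mxE eqxx.
have YuE i : Y u 0 (lshift n i) = (i == b)%:R.
  by have /rowP/(_ i) := YE u.2; rewrite -surjective_pairing !mxE eqxx.
rewrite (bigD1 a) //= [X in _ + X]big1 => [|i ia]; last first.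
  by rewrite big1 // => j _; rewrite XuE (negPf ia) mulr0 mul0r.
rewrite (bigD1 b) //= [X in _ + X + _]big1 => [|j jb]; last first.
  by rewrite YuE (negPf jb) mulr0.
rewrite XuE YuE !eqxx !mulr1 !addr0 => /eqP.
by rewrite oppr_eq0 => /eqP.
Qed.

End BundleLike.

(** * Dependence of the fibre Hessian on the momenta *)

Lemma derive_sum_delta (R : realType) (d : nat) (F : 'rV[R]_d -> R) (x v : 'rV[R]_d) :
  differentiable F x -> 'D_v F x = \sum_j v 0 j * 'D_(delta_mx 0 j) F x.
Proof.
move=> dF; rewrite (deriveE _ dF) [in LHS](row_sum_delta v) linear_sum.
by apply: eq_bigr => j _; rewrite linearZ /= (deriveE _ dF).
Qed.

Lemma smooth_dirderiv (R : realType) (d : nat) (A : set 'rV[R]_d) (F : 'rV[R]_d -> R) v :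
  open A -> smooth_on A F -> smooth_on A ('D_v F).
Proof.
move=> oA sF.
apply: (smooth_eq (F := fun x => \sum_j v 0 j * 'D_(delta_mx 0 j) F x)) => //.
  by move=> x; rewrite inE => Ax; rewrite -derive_sum_delta //; exact: smooth_diff sF _ Ax.
by apply: smooth_sum => // j; apply: smoothM => //; [exact: smooth_cst|exact: smooth_partial].
Qed.

Section FibreHessian.
Context {R : realType} {n : nat}.
Implicit Types F : 'rV[R]_(n + n) -> R.

Lemma derive_fibre F (w : 'rV[R]_(n + n)) (r : 'rV[R]_n) : differentiable F w ->
  'D_(row_mx 0 r) F w = \sum_j r 0 j * dp j F w.
Proof.
move=> dF; rewrite derive_sum_delta // big_split_ord /= big1 ?add0r => [|j _].
  by apply: eq_bigr => j _; rewrite row_mxEr.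
by rewrite row_mxEl mxE mul0r.
Qed.

Lemma derive_fibre_linear F F' (y y' : 'rV[R]_n) (M : 'M[R]_n) :
  (forall p, F' (row_mx y' p) = F (row_mx y (p *m M))) ->
  forall b p, dp b F' (row_mx y' p) = 'D_(row_mx 0 (row b M)) F (row_mx y (p *m M)).
Proof.
move=> FF' b p; apply: derive_along; near=> h.
rewrite delta_rshift !scale_row_mx !add_row_mx !scaler0 !add0r FF' mulmxDl -scalemxAl.
by rewrite rowE.
Unshelve. all: by end_near. Qed.

(** Differentiating twice in the momenta at a fixed position only sees the linear change of
    momenta, whatever the change of positions is. *)
Lemma fibre_hessian_linear F F' (O : set 'rV[R]_(n + n)) (y y' : 'rV[R]_n) (M : 'M[R]_n) :
  open O -> smooth_on O F -> (forall p, O (row_mx y p)) ->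
  (forall p, F' (row_mx y' p) = F (row_mx y (p *m M))) ->
  forall p, fibre_hessian F' (row_mx y' p) =
    M *m fibre_hessian F (row_mx y (p *m M)) *m M^T.
Proof.
move=> oO sF yO FF' p; apply/matrixP => a b; rewrite [LHS]mxE.
have sFb := smooth_dirderiv (row_mx 0 (row b M)) oO sF.
have wO := yO (p *m M).
have FFb := derive_fibre_linear FF' b.
rewrite (@derive_fibre_linear ('D_(row_mx 0 (row b M)) F) (dp b F') y y' M FFb a p).
rewrite (derive_fibre _ (smooth_diff sFb wO)).
have dE j : dp j ('D_(row_mx 0 (row b M)) F) (row_mx y (p *m M)) =
    \sum_k M b k * fibre_hessian F (row_mx y (p *m M)) j k.
  have sdp k : smooth_on O (dp k F) by exact: smooth_partial.
  have E : {near row_mx y (p *m M), 'D_(row_mx 0 (row b M)) F =1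
      \sum_k (fun w => M b k * dp k F w)}.
    apply: (open_near_eq oO) => // w; rewrite inE => Ow.
    rewrite (derive_fibre _ (smooth_diff sF Ow)) fct_sumE.
    by apply: eq_bigr => k _; rewrite mxE.
  have dk k : differentiable (fun w => M b k * dp k F w) (row_mx y (p *m M)).
    by apply: (smooth_diff (A := O)) => //; apply: smoothM => //; exact: smooth_cst.
  rewrite /dp (near_eq_derive _ E) derive_sum => [|k]; last exact: diff_derivable.
  apply: eq_bigr => k _; rewrite [fibre_hessian _ _ _ _]mxE.
  have dFk : derivable (dp k F) (row_mx y (p *m M)) (delta_mx 0 (rshift n j)).
    by apply: diff_derivable; exact: smooth_diff (sdp k) _ wO.
  exact: (deriveZ (M b k) dFk).
under eq_bigr => j _ do rewrite dE mxE mulr_sumr.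
rewrite exchange_big [RHS]mxE; apply: eq_bigr => k _.
rewrite [(M *m _) a k]mxE mulr_suml [M^T k b]mxE; apply: eq_bigr => j _.
by rewrite mulrCA mulrC.
Qed.

Lemma gup_continuous_fibre F (O : set 'rV[R]_(n + n)) (y p : 'rV[R]_n) i j :
  open O -> smooth_on O F -> O (row_mx y 0) ->
  {for 0, continuous (fun t : R => gup F (row_mx y (t *: p)) i j)}.
Proof.
move=> oO sF O0.
have c1 : {for (row_mx y (0 *: p) : 'rV[R]_(n + n)), continuous (fun w => gup F w i j)}.
  apply: differentiable_continuous; rewrite scale0r.
  apply: (smooth_diff (A := O)) => //.
  apply: (smooth_eq (F := fun w => 2^-1 * dp i (dp j F) w)) => //.
    by move=> w _; rewrite /gup !mxE.
  by apply: smoothM => //; [exact: smooth_cst|exact/smooth_partial/smooth_partial].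
have c2 : {for 0, continuous (fun t : R => row_mx y (t *: p))}.
  apply: differentiable_continuous; apply/differentiable_rV => k.
  case: (splitP k) => l kl.
    have -> : k = lshift n l by apply: val_inj.
    have -> : (fun t : R => row_mx y (t *: p) 0 (lshift n l)) = cst (y 0 l).
      by apply/funext => t; rewrite row_mxEl.
    exact: differentiable_cst.
  have -> : k = rshift n l by apply: val_inj.
  have -> : (fun t : R => row_mx y (t *: p) 0 (rshift n l)) = (fun t : R => t *: p 0 l).
    by apply/funext => t; rewrite row_mxEr mxE.
  exact: differentiableZl.
exact: (continuous_comp c2 c1).
Qed.

End FibreHessian.

Lemma constant_on_ray (R : realType) (h : R -> R) :
  (forall t : R, 0 < t -> is_derive t 1 h 0) -> forall t : R, 0 < t -> h t = h 1.
Proof.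
move=> dh.
have lem a b : 0 < a -> a < b -> h b = h a.
  move=> a0 ab; apply/eqP; rewrite -subr_eq0.
  have dab (x : R) : x \in `]a, b[ -> is_derive x 1 h 0.
    by rewrite in_itv /= => /andP[ax _]; apply: dh; exact: lt_trans ax.
  have cab : {within `[a, b], continuous h}.
    apply: continuous_in_subspaceT => x; rewrite inE /= in_itv /= => /andP[ax _].
    have [dx _] := dh x (lt_le_trans a0 ax).
    by apply: differentiable_continuous; exact/derivable1_diffP.
  by have [c _ ->] := MVT ab dab cab; rewrite mul0r.
move=> t t0; have [t1|t1|-> //] := ltgtP t 1.
  by rewrite -(lem t 1).
by rewrite (lem 1 t).
Qed.

Lemma constant_at_origin (R : realType) (h : R -> R) :
  {for 0, continuous h} -> (forall t : R, 0 < t -> h t = h 1) -> h 0 = h 1.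
Proof.
move=> ch h1; have hr : h t @[t --> 0^'+] --> h 0 by exact: cvg_at_right_filter.
have h1r : h t @[t --> 0^'+] --> h 1.
  have c1 : (fun=> h 1) @ (0^'+ : set_system R) --> h 1 by exact: cvg_cst.
  apply: cvg_trans c1; apply: near_eq_cvg; near=> t; apply/esym/h1.
  by near: t; exact: nbhs_right_gt.
exact: (cvg_unique _ hr h1r).
Unshelve. all: by end_near. Qed.

Lemma differentiable_line (R : realType) (W : normedModType R) (w z : W) (s : R) :
  differentiable (fun h : R => h *: z + w) s.
Proof.
have d1 : differentiable (fun h : R => h *: z) s.
  by apply: (differentiableZl (k := id)).
exact: (differentiableD d1 (differentiable_cst w s)).
Qed.

Lemma near_line (R : realType) (W : normedModType R) (O : set W) (w z : W) :
  open O -> O w -> \forall h \near (0 : R), O (h *: z + w).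
Proof.
move=> oO Ow; have c : {for 0, continuous (fun h : R => h *: z + w)}.
  by apply: differentiable_continuous; exact: differentiable_line.
have : nbhs (0 *: z + w) O by rewrite scale0r add0r; exact: open_nbhs_nbhs.
exact: c.
Qed.

(** At t p the derivative in the direction t p is t times the derivative in t of the
    restriction of [g] to the ray. *)
Lemma constant_along_fibre_ray (R : realType) (n : nat) (g : 'rV[R]_(n + n) -> R)
    (y p : 'rV[R]_n) :
  (forall t : R, 0 < t -> differentiable g (row_mx y (t *: p))) ->
  (forall t : R, 0 < t -> 'D_(row_mx 0 (t *: p)) g (row_mx y (t *: p)) = 0) ->
  forall t : R, 0 < t -> g (row_mx y (t *: p)) = g (row_mx y p).
Proof.
move=> dg Dg t t0; rewrite -[in RHS](scale1r p).
pose z : 'rV[R]_(n + n) := row_mx 0 p; pose w : 'rV[R]_(n + n) := row_mx y 0.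
have wE (s : R) : row_mx y (s *: p) = s *: z + w.
  by rewrite scale_row_mx add_row_mx scaler0 add0r addr0.
apply: (constant_on_ray (h := fun s => g (row_mx y (s *: p)))) t0 => s s0.
have -> : (fun s => g (row_mx y (s *: p))) = g \o (fun s => s *: z + w).
  by apply/funext => r; rewrite wE.
have dl : differentiable (fun s : R => s *: z + w) s.
  exact: differentiable_line.
have dgs : differentiable g (s *: z + w) by rewrite -wE; exact: dg.
apply: DeriveDef.
  by apply: diff_derivable; apply: differentiable_comp.
have -> : 'D_1 (g \o (fun s => s *: z + w)) s = 'D_z g (s *: z + w).
  apply: derive_along; near=> h.
  by rewrite /= scalerDl addrA /GRing.scale /= mulr1.
have := Dg s s0; rewrite wE.
have -> : row_mx 0 (s *: p) = s *: z by rewrite scale_row_mx scaler0.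
rewrite !(deriveE _ dgs) linearZ /= => /eqP.
by rewrite scaler_eq0 (gt_eqF s0) /= => /eqP.
Unshelve. all: by end_near. Qed.

(** The Hamiltonian is smooth across the zero section, so a fibre Hessian which is constant
    on an open ray takes the same value at the origin of the fibre. All rays meet there,
    also when the fibre minus its origin is disconnected. *)
Lemma gup_ray_origin (R : realType) (n : nat) (F : 'rV[R]_(n + n) -> R)
    (O : set 'rV[R]_(n + n)) (y p : 'rV[R]_n) :
  open O -> smooth_on O F -> O (row_mx y 0) ->
  (forall t : R, 0 < t -> gup F (row_mx y (t *: p)) = gup F (row_mx y p)) ->
  gup F (row_mx y p) = gup F (row_mx y 0).
Proof.
move=> oO sF O0 ray; apply/matrixP => i j.
have : gup F (row_mx y (0 *: p)) i j = gup F (row_mx y (1 *: p)) i j.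
  apply: (constant_at_origin (h := fun t => gup F (row_mx y (t *: p)) i j)).
    exact: gup_continuous_fibre oO sF O0.
  by move=> t t0; apply: (congr1 (fun M : 'M[R]_n => M i j)); rewrite scale1r; exact: ray.
by rewrite scale0r scale1r; exact: esym.
Qed.

Lemma neq0_open (R : realType) (n : nat) : open [set p : 'rV[R]_n | p != 0].
Proof.
have -> : [set p : 'rV[R]_n | p != 0] = ~` [set 0].
  by apply/seteqP; split=> p /=; [move/eqP|move/eqP].
apply: closed_openC; apply: accessible_closed_set1; apply: hausdorff_accessible.
exact: norm_hausdorff.
Qed.

Section OneFactor.
Context {R : realType} {n : nat} {T : Type} (A : atlas R n T).
Variable H : T * 'rV[R]_n -> R.
Local Notation CA := (cotangent A).
Hypothesis sA : smooth_atlas A.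
Let sCA : smooth_atlas CA. Proof. exact: cot_smooth_atlas. Qed.

Lemma cot_slitP (c : idx A) w :
  chart_img (A := CA) c [set u | u.2 != 0] w <-> chart_img c setT (lsubmx w) /\ rsubmx w != 0.
Proof.
split=> /=.
  move=> /(cot_chart_imgP sA)[iw]; rewrite cot_invE /= => pw; split=> //.
  by apply: contra_neq pw => ->; rewrite mul0mx.
move=> [iw pw]; apply/(cot_chart_imgP sA); split=> //; rewrite cot_invE /=.
have /(chart_imgP sA)[dw _ _] := iw.
have u : (tjac (chart_at A (inv c (lsubmx w))) c (inv c (lsubmx w)))^T \in unitmx.
  by rewrite unitmx_tr tjac_unit //; exact: (atlas_cover sA).
by apply: contra_neq pw => pE; rewrite -[rsubmx w](mulmxK u) pE mul0mx.
Qed.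

Lemma lexpr_chart (c c' : idx A) x p : dom c x -> dom c' x ->
  lexpr H c' (row_mx (crd c' x) p) = lexpr H c (row_mx (crd c x) (p *m (tjac c c' x)^T)).
Proof.
move=> dx dx'; have d0 := atlas_cover sA x.
rewrite /lexpr /comp !cot_invE !row_mxKl !row_mxKr !(atlas_crdK sA) //.
by rewrite -mulmxA -trmx_mul tjac_comp.
Qed.

Hypothesis sH : smooth_fun CA setT H.

(** In another chart the tensor g^ij at (x, p) is congruent to the one in the chart
    selected at x by a matrix that depends on x only. *)
Lemma pseudo_riemannian_of_origin :
  (forall x p (c := chart_at A x),
     gup (lexpr H c) (row_mx (crd c x) p) = gup (lexpr H c) (row_mx (crd c x) 0)) ->
  pseudo_riemannian A H.
Proof.
move=> H0 c _ p p' [x [dx _] <-] _ _.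
suff E0 : gup (lexpr H c) (row_mx (crd c x) p) = gup (lexpr H c) (row_mx (crd c x) p').
  by rewrite /glow E0.
pose c0 := chart_at A x; have d0 : dom c0 x := atlas_cover sA x.
pose O := chart_img (A := CA) c0 setT.
have oO : open O by exact: (chart_img_open_total sCA).
have yO q : O (row_mx (crd c0 x) q).
  by apply/(cot_chart_imgP sA); split=> //; rewrite row_mxKl; exact: chart_img_crd.
suff E q : gup (lexpr H c) (row_mx (crd c x) q) = (tjac c0 c x)^T *m
    gup (lexpr H c0) (row_mx (crd c0 x) 0) *m (tjac c0 c x)^T^T.
  exact: etrans (E p) (esym (E p')).
pose M := (tjac c0 c x)^T.
transitivity (M *m gup (lexpr H c0) (row_mx (crd c0 x) (q *m M)) *m M^T); last first.
  exact: (congr1 (fun g => M *m g *m M^T) (H0 x (q *m M))).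
have hE := fibre_hessian_linear oO (sH (c := c0)) yO (fun p => lexpr_chart p d0 dx) q.
by rewrite [LHS]/gup hE /gup -scalemxAr -scalemxAl.
Qed.

Lemma pseudo_riemannian_gup (c : idx A) (y p p' : 'rV[R]_n) : pseudo_riemannian A H ->
  chart_img c setT y -> p != 0 -> p' != 0 ->
  gup (lexpr H c) (row_mx y p) = gup (lexpr H c) (row_mx y p').
Proof.
move=> pr iy p0 p0'; have E := congr1 (@invmx _ _) (pr c y p p' iy p0 p0').
exact: etrans (esym (invmxK _)) (etrans E (invmxK _)).
Qed.

(** A matrix congruent to a symmetric one is symmetric. *)
Lemma signature_sym (k r : nat) (M : 'M[R]_k) : has_signature M r -> M^T = M.
Proof.
move=> [_ [P uP PE]]; have uPT : P^T \in unitmx by rewrite unitmx_tr.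
have : (P *m M *m P^T)^T = P *m M *m P^T by rewrite PE tr_diag_mx.
rewrite !trmx_mul trmxK mulmxA => /(congr1 (mulmx (invmx P))).
rewrite !mulmxA mulVmx // !mul1mx => /(congr1 (mulmx^~ (invmx P^T))).
by rewrite !mulmxK.
Qed.

End OneFactor.

(** * Warped product Hamiltonians *)

Section Split.
Context {R : realType} {n m : nat}.
Local Notation N := (n + m)%N.
Implicit Types w v : 'rV[R]_(N + N).

(** In canonical coordinates, the projection of T^*(M1 x M2) to T^*M1. *)
Definition phase1 w : 'rV[R]_(n + n) := row_mx (lsubmx (lsubmx w)) (lsubmx (rsubmx w)).
Definition phase2 w : 'rV[R]_(m + m) := row_mx (rsubmx (lsubmx w)) (rsubmx (rsubmx w)).

Lemma phase1P h v w : phase1 (h *: v + w) = h *: phase1 v + phase1 w.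
Proof. by rewrite /phase1 !linearP scale_row_mx add_row_mx. Qed.

Lemma phase2P h v w : phase2 (h *: v + w) = h *: phase2 v + phase2 w.
Proof. by rewrite /phase2 !linearP scale_row_mx add_row_mx. Qed.

Lemma smooth_phase1 (O : set 'rV[R]_(N + N)) : open O -> smooth_on O phase1.
Proof.
move=> oO; apply: smooth_row_mx => //.
  apply: (smooth_compV (B := setT) (F := @lsubmx R 1 n m) (Phi := @lsubmx R 1 N N)) => //.
  - exact: openT.
  - exact/smooth_lsubmx/openT.
  - exact: smooth_lsubmx.
apply: (smooth_compV (B := setT) (F := @lsubmx R 1 n m) (Phi := @rsubmx R 1 N N)) => //.
- exact: openT.
- exact/smooth_lsubmx/openT.
- exact: smooth_rsubmx.
Qed.

Lemma smooth_phase2 (O : set 'rV[R]_(N + N)) : open O -> smooth_on O phase2.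
Proof.
move=> oO; apply: smooth_row_mx => //.
  apply: (smooth_compV (B := setT) (F := @rsubmx R 1 n m) (Phi := @lsubmx R 1 N N)) => //.
  - exact: openT.
  - exact/smooth_rsubmx/openT.
  - exact: smooth_lsubmx.
apply: (smooth_compV (B := setT) (F := @rsubmx R 1 n m) (Phi := @rsubmx R 1 N N)) => //.
- exact: openT.
- exact/smooth_rsubmx/openT.
- exact: smooth_rsubmx.
Qed.

Lemma phase1_dl (i : 'I_n) : phase1 (delta_mx 0 (rshift N (lshift m i))) = delta_mx 0 (rshift n i).
Proof. by rewrite /phase1 !delta_rshift row_mxKl row_mxKr delta_lshift row_mxKl linear0. Qed.

Lemma phase1_dr (j : 'I_m) : phase1 (delta_mx 0 (rshift N (rshift n j))) = 0.
Proof. by rewrite /phase1 !delta_rshift row_mxKl row_mxKr row_mxKl linear0 row_mx0. Qed.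

Lemma phase2_dl (i : 'I_n) : phase2 (delta_mx 0 (rshift N (lshift m i))) = 0.
Proof. by rewrite /phase2 !delta_rshift row_mxKl row_mxKr delta_lshift row_mxKr linear0 row_mx0. Qed.

Lemma phase2_dr (j : 'I_m) : phase2 (delta_mx 0 (rshift N (rshift n j))) = delta_mx 0 (rshift m j).
Proof. by rewrite /phase2 !delta_rshift row_mxKl row_mxKr row_mxKr linear0. Qed.

Variables (O1 : set 'rV[R]_(n + n)) (O2 : set 'rV[R]_(m + m)) (phi : 'rV[R]_N -> R).
Variable O : set 'rV[R]_(N + N).
Hypotheses (o1 : open O1) (o2 : open O2) (oO : open O).
Hypothesis OO : forall w, O w -> O1 (phase1 w) /\ O2 (phase2 w).

Definition warped_expr (F1 : 'rV[R]_(n + n) -> R) (F2 : 'rV[R]_(m + m) -> R) w : R :=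
  F1 (phase1 w) + phi (lsubmx w) * F2 (phase2 w).

(** The warping factor depends on the position only, so it is constant along the lines in
    a vertical direction. *)
Lemma derive_warped F1 F2 v w : smooth_on O1 F1 -> smooth_on O2 F2 -> O w ->
  lsubmx v = 0 ->
  'D_v (warped_expr F1 F2) w = warped_expr ('D_(phase1 v) F1) ('D_(phase2 v) F2) w.
Proof.
move=> s1 s2 Ow lv; have [Ow1 Ow2] := OO Ow.
have d1 : derivable (F1 \o phase1) w v.
  apply: diff_derivable; apply: differentiable_comp; last exact: smooth_diff s1 _ Ow1.
  exact: smooth_diff (smooth_phase1 oO) _ Ow.
have d2 : derivable (F2 \o phase2) w v.
  apply: diff_derivable; apply: differentiable_comp; last exact: smooth_diff s2 _ Ow2.
  exact: smooth_diff (smooth_phase2 oO) _ Ow.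
have e1 : 'D_v (F1 \o phase1) w = 'D_(phase1 v) F1 (phase1 w).
  by apply: derive_along; near=> h; rewrite /comp phase1P.
have e2 : 'D_v (F2 \o phase2) w = 'D_(phase2 v) F2 (phase2 w).
  by apply: derive_along; near=> h; rewrite /comp phase2P.
rewrite /warped_expr -e1 -e2.
transitivity ('D_v (F1 \o phase1 + phi (lsubmx w) *: (F2 \o phase2)) w).
  apply: derive_along; near=> h; rewrite /warped_expr.
  have -> : lsubmx (h *: v + w) = lsubmx w by rewrite linearP /= lv scaler0 add0r.
  by [].
have d2' : derivable (phi (lsubmx w) *: (F2 \o phase2)) w v by exact: derivableZ.
by rewrite (deriveD d1 d2') (deriveZ (phi (lsubmx w)) d2).
Unshelve. all: by end_near. Qed.

Lemma fibre_hessian_warped F F1 F2 w : smooth_on O1 F1 -> smooth_on O2 F2 ->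
  {in O, F =1 warped_expr F1 F2} -> O w ->
  fibre_hessian F w = block_mx (fibre_hessian F1 (phase1 w)) 0 0
    (phi (lsubmx w) *: fibre_hessian F2 (phase2 w)).
Proof.
move=> s1 s2 FE Ow.
have lv (a : 'I_N) : lsubmx (delta_mx 0 (rshift N a) : 'rV[R]_(N + N)) = 0.
  by rewrite delta_rshift row_mxKl.
have E a b : dp a (dp b F) w = warped_expr
    ('D_(phase1 (delta_mx 0 (rshift N a))) ('D_(phase1 (delta_mx 0 (rshift N b))) F1))
    ('D_(phase2 (delta_mx 0 (rshift N a))) ('D_(phase2 (delta_mx 0 (rshift N b))) F2)) w.
  rewrite -derive_warped //; try exact: smooth_dirderiv.
  apply: near_eq_derive; apply: (open_near_eq oO) => // w'; rewrite inE => Ow'.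
  rewrite -derive_warped //; apply: near_eq_derive; exact: (open_near_eq oO).
have z1 j (g : 'rV[R]_(n + n) -> R) :
    'D_(phase1 (delta_mx 0 (rshift N (rshift n j)))) g = fun=> 0.
  by rewrite phase1_dr; apply/funext => x; exact: derive0.
have z2 i (g : 'rV[R]_(m + m) -> R) :
    'D_(phase2 (delta_mx 0 (rshift N (lshift m i)))) g = fun=> 0.
  by rewrite phase2_dl; apply/funext => x; exact: derive0.
have Dc (d : nat) (v x : 'rV[R]_d) : 'D_v (fun=> 0 : R) x = 0 by exact: derive_cst.
apply/matrixP => a b; rewrite [LHS]mxE E /warped_expr.
pose comb := congr2 (fun s t => s + phi (lsubmx w) * t).
case: (splitP a) => i ai; case: (splitP b) => j bj.
- have -> : a = lshift m i by apply: val_inj.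
  have -> : b = lshift m j by apply: val_inj.
  rewrite block_mxEul; apply: etrans (comb _ _ _ _ _ (congr1 (@^~ (phase2 w)) (z2 i _))) _.
    by rewrite (phase1_dl i) (phase1_dl j).
  by rewrite mulr0 addr0 [RHS]mxE.
- have -> : a = lshift m i by apply: val_inj.
  have -> : b = rshift n j by apply: val_inj.
  rewrite block_mxEur; apply: etrans (comb _ _ _ _ _ (congr1 (@^~ (phase2 w)) (z2 i _))) _.
    by rewrite (z1 j); exact: Dc.
  by rewrite mulr0 addr0 [RHS]mxE.
- have -> : a = rshift n i by apply: val_inj.
  have -> : b = lshift m j by apply: val_inj.
  rewrite block_mxEdl; apply: etrans (comb _ _ _ _ (congr1 (@^~ (phase1 w)) (z1 i _)) _) _.
    by rewrite (z2 j); exact: Dc.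
  by rewrite mulr0 addr0 [RHS]mxE.
- have -> : a = rshift n i by apply: val_inj.
  have -> : b = rshift n j by apply: val_inj.
  rewrite block_mxEdr; apply: etrans (comb _ _ _ _ (congr1 (@^~ (phase1 w)) (z1 i _)) _) _.
    by rewrite (phase2_dr i) (phase2_dr j).
  by rewrite add0r [RHS]mxE [X in _ = _ * X]mxE.
Qed.

Lemma gup_warped F F1 F2 w : smooth_on O1 F1 -> smooth_on O2 F2 ->
  {in O, F =1 warped_expr F1 F2} -> O w ->
  gup F w = block_mx (gup F1 (phase1 w)) 0 0 (phi (lsubmx w) *: gup F2 (phase2 w)).
Proof.
move=> s1 s2 FE Ow; rewrite /gup (fibre_hessian_warped s1 s2 FE Ow).
by rewrite scale_block_mx !scaler0 !scalerA [2^-1 * _]mulrC.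
Qed.

End Split.

Section Warped.
Context {R : realType} {n m : nat} {M1 M2 : topologicalType}.
Context (A1 : atlas R n M1) (A2 : atlas R m M2).
Hypotheses (hM1 : smooth_manifold A1) (hM2 : smooth_manifold A2).
Variables (H1 : M1 * 'rV[R]_n -> R) (H2 : M2 * 'rV[R]_m -> R) (f : M1 -> R).
Hypotheses (hH1 : hamiltonian_space A1 H1) (hH2 : hamiltonian_space A2 H2).
Hypotheses (sf : smooth_fun A1 setT f) (fpos : forall x, 0 < f x).
Local Notation N := (n + m)%N.
Local Notation P := (prod_atlas A1 A2).
Local Notation H := (warped_hamiltonian H1 H2 f).
Local Notation slit := (@slit_cotangent R n m M1 M2).

Let s1 : smooth_atlas A1. Proof. exact: manifold_smooth_atlas. Qed.
Let s2 : smooth_atlas A2. Proof. exact: manifold_smooth_atlas. Qed.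
Let hP : smooth_manifold P. Proof. exact: prod_manifold. Qed.
Let sP : smooth_atlas P. Proof. exact: manifold_smooth_atlas. Qed.
Let sH1 : smooth_fun (cotangent A1) setT H1. Proof. by have [] := hH1. Qed.
Let sH2 : smooth_fun (cotangent A2) setT H2. Proof. by have [] := hH2. Qed.

(** Derivatives of a product map split, in directions as well as in values. *)
Lemma tjac_prod (c c' : idx P) x : dom c x -> dom c' x ->
  tjac c c' x = block_mx (tjac c.1 c'.1 x.1) 0 0 (tjac c.2 c'.2 x.2).
Proof.
move=> dx dx'; have [d1 d2] := dx; have [d1' d2'] := dx'.
apply/row_matrixP => i; rewrite !rowE; set v := delta_mx 0 i.
rewrite -[v in RHS]hsubmxK mul_row_block !mulmx0 addr0 add0r.
rewrite (tjac_derive sP _ dx dx') (tjac_derive s1 _ d1 d1') (tjac_derive s2 _ d2 d2').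
have t1 := transition_diff s1 d1 d1'; have t2 := transition_diff s2 d2 d2'.
have tP := transition_diff sP dx dx'.
apply/rowP => j; rewrite (derive_rV _ _ tP); case: (splitP j) => k jk.
- have -> : j = lshift m k by apply: val_inj.
  rewrite row_mxEl (derive_rV _ _ t1); apply: derive_along; near=> h.
  by rewrite /= row_mxEl linearP /= row_mxKl.
- have -> : j = rshift n k by apply: val_inj.
  rewrite row_mxEr (derive_rV _ _ t2); apply: derive_along; near=> h.
  by rewrite /= row_mxEr linearP /= row_mxKr.
Unshelve. all: by end_near. Qed.

Definition warping_expr (c : idx P) (y : 'rV[R]_N) : R := f (inv c.1 (lsubmx y)).

Lemma prod_chart_imgP (c : idx P) y :
  chart_img c setT y <-> chart_img c.1 setT (lsubmx y) /\ chart_img c.2 setT (rsubmx y).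
Proof.
have -> : [set: M1 * M2] = [set: M1] `*` [set: M2] by apply/seteqP; split.
by rewrite prod_chart_img.
Qed.

Lemma lexpr_warped (c : idx P) w : chart_img c setT (lsubmx w) ->
  lexpr H c w = warped_expr (warping_expr c) (lexpr H1 c.1) (lexpr H2 c.2) w.
Proof.
move=> /(chart_imgP sP)[dw _ _]; have d0 := atlas_cover sP (inv c (lsubmx w)).
rewrite /warped_expr /lexpr /comp !cot_invE (tjac_prod d0 dw) tr_block_mx !trmx0.
rewrite /warped_hamiltonian /cot_fst /cot_snd /warping_expr /=.
rewrite -[rsubmx w]hsubmxK mul_row_block !mulmx0 addr0 add0r !row_mxKl !row_mxKr.
by [].
Qed.

Let O1 (c : idx P) := chart_img (A := cotangent A1) c.1 setT.
Let O2 (c : idx P) := chart_img (A := cotangent A2) c.2 setT.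
Let OT (c : idx P) := chart_img (A := cotangent P) c setT.
Let oO1 c : open (O1 c). Proof. exact: (chart_img_open_total (cot_smooth_atlas s1)). Qed.
Let oO2 c : open (O2 c). Proof. exact: (chart_img_open_total (cot_smooth_atlas s2)). Qed.
Let oOT c : open (OT c). Proof. exact: (chart_img_open_total (cot_smooth_atlas sP)). Qed.

Let OTbase c w : OT c w -> chart_img c setT (lsubmx w).
Proof. by move=> /(cot_chart_imgP sP)[]. Qed.

Let OTO c w : OT c w -> O1 c (phase1 w) /\ O2 c (phase2 w).
Proof.
move=> /OTbase/prod_chart_imgP[i1 i2]; split.
  by apply/(cot_chart_imgP s1); split=> //; rewrite row_mxKl.
by apply/(cot_chart_imgP s2); split=> //; rewrite row_mxKl.
Qed.

Let lexprE c : {in OT c, lexpr H c =1 warped_expr (warping_expr c) (lexpr H1 c.1) (lexpr H2 c.2)}.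
Proof. by move=> w; rewrite inE => /OTbase; exact: lexpr_warped. Qed.

Lemma warped_smooth : smooth_fun (cotangent P) setT H.
Proof.
move=> c; change (idx P) in c; rewrite -/(OT c).
apply: (smooth_eq (F := fun w => (lexpr H1 c.1 \o phase1) w +
  ((f \o @inv _ _ _ A1 c.1) \o (@lsubmx R 1 n m \o @lsubmx R 1 N N)) w *
  (lexpr H2 c.2 \o phase2) w)) => //.
  by move=> w Ow; have := lexprE Ow.
have c1 : smooth_on (OT c) (lexpr H1 c.1 \o phase1).
  apply: (smooth_comp (B := O1 c)) => //; first by move=> w /OTO[].
    exact: sH1.
  exact: smooth_phase1.
have c2 : smooth_on (OT c) (lexpr H2 c.2 \o phase2).
  apply: (smooth_comp (B := O2 c)) => //; first by move=> w /OTO[].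
    exact: sH2.
  exact: smooth_phase2.
apply: smoothD => //; apply: smoothM => //.
apply: (smooth_comp (B := chart_img c.1 setT)) => //.
- by move=> w /OTbase/prod_chart_imgP[].
- apply: (smooth_compV (B := setT) (F := @lsubmx R 1 n m) (Phi := @lsubmx R 1 N N)) => //.
  + exact: openT.
  + exact/smooth_lsubmx/openT.
  + exact: smooth_lsubmx.
Qed.

Lemma warped_gup (c : idx P) w : OT c w -> gup (lexpr H c) w =
  block_mx (gup (lexpr H1 c.1) (phase1 w)) 0 0
    (warping_expr c (lsubmx w) *: gup (lexpr H2 c.2) (phase2 w)).
Proof.
move=> Ow; apply: (gup_warped (O1 := O1 c) (O2 := O2 c) (O := OT c)) => //.
- exact: OTO.
- exact: sH1.
- exact: sH2.
Qed.

Lemma slitP (c : idx P) w : chart_img (A := cotangent P) c slit w <->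
  [/\ OT c w, chart_img (A := cotangent A1) c.1 [set u | u.2 != 0] (phase1 w)
    & chart_img (A := cotangent A2) c.2 [set u | u.2 != 0] (phase2 w)].
Proof.
have E : OT c w -> (slit (inv (a := cotangent P) c w) <->
    (lsubmx (rsubmx w) != 0 /\ rsubmx (rsubmx w) != 0)).
  move=> /OTbase/(chart_imgP sP)[dw _ _]; have d0 := atlas_cover sP (inv c (lsubmx w)).
  have [d1 d2] := dw; have [d01 d02] := d0.
  rewrite cot_invE (tjac_prod d0 dw) tr_block_mx !trmx0 /slit_cotangent /cot_fst /cot_snd /=.
  rewrite -[rsubmx w in X in X <-> _]hsubmxK mul_row_block !mulmx0 addr0 add0r row_mxKl row_mxKr.
  have u1 := tjac_unit s1 d01 d1; have u2 := tjac_unit s2 d02 d2.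
  have nz (k : nat) (p : 'rV[R]_k) (M : 'M[R]_k) : M \in unitmx -> (p *m M^T != 0) = (p != 0).
    rewrite -unitmx_tr => uM; apply/idP/idP.
      by apply: contra_neq => ->; rewrite mul0mx.
    by apply: contra_neq => p0; rewrite -[p](mulmxK uM) p0 mul0mx.
  by rewrite !nz.
split.
  move=> /(cot_chart_imgP sP)[iw Sw]; have Ow : OT c w by apply/(cot_chart_imgP sP).
  have [i1 i2] := (prod_chart_imgP _ _).1 iw; have [p1 p2] := (E Ow).1 Sw.
  split=> //.
    by apply/(cot_slitP s1); rewrite row_mxKl row_mxKr.
  by apply/(cot_slitP s2); rewrite row_mxKl row_mxKr.
move=> [Ow /(cot_slitP s1)[_ p1] /(cot_slitP s2)[_ p2]].
rewrite row_mxKr in p1; rewrite row_mxKr in p2.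
apply/(cot_chart_imgP sP); split; first exact: OTbase.
by apply/(E Ow).2.
Qed.

Lemma slit_open (c : idx P) : open (chart_img (A := cotangent P) c slit).
Proof.
have op1 : open [set w : 'rV[R]_(N + N) | lsubmx (rsubmx w) != 0 :> 'rV[R]_n].
  have o : open (@rsubmx R 1 N N @^-1` (@lsubmx R 1 n m @^-1` [set p | p != 0])).
    apply: open_comp => [w _|]; first exact: continuous_rsubmx.
    by apply: open_comp (@neq0_open _ _) => w _; exact: continuous_lsubmx.
  exact: o.
have op2 : open [set w : 'rV[R]_(N + N) | rsubmx (rsubmx w) != 0 :> 'rV[R]_m].
  have o : open (@rsubmx R 1 N N @^-1` (@rsubmx R 1 n m @^-1` [set p | p != 0])).
    apply: open_comp => [w _|]; first exact: continuous_rsubmx.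
    by apply: open_comp (@neq0_open _ _) => w _; exact: continuous_rsubmx.
  exact: o.
suff -> : chart_img (A := cotangent P) c slit = OT c `&`
    ([set w : 'rV[R]_(N + N) | lsubmx (rsubmx w) != 0 :> 'rV[R]_n] `&`
     [set w : 'rV[R]_(N + N) | rsubmx (rsubmx w) != 0 :> 'rV[R]_m]).
  by apply: openI => //; apply: openI.
apply/seteqP; split=> w.
  by move=> /slitP[Ow /(cot_slitP s1)[_ p1] /(cot_slitP s2)[_ p2]]; rewrite !row_mxKr in p1 p2.
move=> [Ow [/= p1 p2]]; have [/(cot_chart_imgP s1)[i1 _] /(cot_chart_imgP s2)[i2 _]] := OTO Ow.
apply/slitP; split=> //.
  by apply/(cot_slitP s1); rewrite row_mxKr.
by apply/(cot_slitP s2); rewrite row_mxKr.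
Qed.

Lemma warping_expr_gt0 (c : idx P) y : 0 < warping_expr c y.
Proof. exact: fpos. Qed.

Lemma warped_gup_unit (c : idx P) w : chart_img (A := cotangent P) c slit w ->
  gup (lexpr H c) w \in unitmx.
Proof.
move=> /slitP[Ow i1 i2]; rewrite warped_gup // unitmxE det_ublock unitrM.
have [_ u1 _] := hH1; have [_ u2 _] := hH2.
have half : (2^-1 : R) \is a GRing.unit by rewrite unitfE invr_eq0 pnatr_eq0.
apply/andP; split; rewrite -unitmxE; first by rewrite unitmxZ // u1.
by rewrite unitmxZ ?unitfE ?gt_eqF ?warping_expr_gt0 // unitmxZ // u2.
Qed.

Lemma warped_gup_sym (c : idx P) w : chart_img (A := cotangent P) c slit w ->
  (gup (lexpr H c) w)^T = gup (lexpr H c) w.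
Proof.
move=> /slitP[Ow i1 i2]; rewrite warped_gup // tr_block_mx !trmx0.
have [_ _ [r1 g1]] := hH1; have [_ _ [r2 g2]] := hH2.
have e1 : (gup (lexpr H1 c.1) (phase1 w))^T = gup (lexpr H1 c.1) (phase1 w).
  by rewrite /gup [LHS]linearZ /= (signature_sym (g1 _ _ i1)).
have e2 : (gup (lexpr H2 c.2) (phase2 w))^T = gup (lexpr H2 c.2) (phase2 w).
  by rewrite /gup [LHS]linearZ /= (signature_sym (g2 _ _ i2)).
by rewrite e1 [X in block_mx _ _ _ X]linearZ /= e2.
Qed.

Variable G : (M1 * M2) * 'rV[R]_N -> 'rV[R]_(N + N) -> 'rV[R]_(N + N) -> R.
Variable nabla : ((M1 * M2) * 'rV[R]_N -> 'rV[R]_(N + N)) ->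
  ((M1 * M2) * 'rV[R]_N -> 'rV[R]_(N + N)) -> (M1 * M2) * 'rV[R]_N -> 'rV[R]_(N + N).
Hypothesis hG : sasaki_metric P H slit G.
Hypothesis hnabla : levi_civita (cotangent P) slit G nabla.

Let sHslit : smooth_fun (cotangent P) slit H.
Proof.
move=> c; change (idx P) in c; apply: smooth_subset (@warped_smooth c).
exact: (chart_imgS (A := cotangent P)).
Qed.

(** With both factors pseudo-Riemannian, g_ab is constant on short vertical lines: they
    stay in the slit bundle, where neither momentum vanishes. *)
Lemma warped_bundle_like_of_riemannian :
  pseudo_riemannian A1 H1 -> pseudo_riemannian A2 H2 -> bundle_like P H slit G nabla.
Proof.
move=> pr1 pr2.
apply: (bundle_like_of_derive0 hP slit_open sHslit warped_gup_unit warped_gup_sym hG hnabla).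
move=> c w z a b Sw lz; change (idx P) in c.
apply: derive_affine; near=> h.
have Swh : chart_img (A := cotangent P) c slit (h *: z + w).
  by near: h; apply: near_line => //; exact: slit_open.
rewrite scaler0 add0r.
suff E : gup (lexpr H c) (h *: z + w) = gup (lexpr H c) w by rewrite /glow E.
have [Ow /(cot_slitP s1)[i1 p1] /(cot_slitP s2)[i2 p2]] := (slitP _ _).1 Sw.
have [Owh /(cot_slitP s1)[_ p1'] /(cot_slitP s2)[_ p2']] := (slitP _ _).1 Swh.
have lE : lsubmx (h *: z + w) = lsubmx w by rewrite linearP /= lz scaler0 add0r.
have e1 : gup (lexpr H1 c.1) (phase1 (h *: z + w)) = gup (lexpr H1 c.1) (phase1 w).
  rewrite -[phase1 w]hsubmxK -[phase1 (_ + _)]hsubmxK.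
  have -> : lsubmx (phase1 (h *: z + w)) = lsubmx (phase1 w) by rewrite !row_mxKl lE.
  exact: pseudo_riemannian_gup.
have e2 : gup (lexpr H2 c.2) (phase2 (h *: z + w)) = gup (lexpr H2 c.2) (phase2 w).
  rewrite -[phase2 w]hsubmxK -[phase2 (_ + _)]hsubmxK.
  have -> : lsubmx (phase2 (h *: z + w)) = lsubmx (phase2 w) by rewrite !row_mxKl lE.
  exact: pseudo_riemannian_gup.
by rewrite (warped_gup Owh) (warped_gup Ow) e1 e2 lE.
Unshelve. all: by end_near. Qed.

(** The Liouville field of the product scales both momenta at once, so its flow acts on
    each block of g^ab by scaling the momentum of the corresponding factor. *)
Lemma warped_gup_ray x1 x2 (p1 : 'rV[R]_n) (p2 : 'rV[R]_m) (t : R) :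
  bundle_like P H slit G nabla -> p1 != 0 -> p2 != 0 -> 0 < t ->
  let c1 := chart_at A1 x1 in let c2 := chart_at A2 x2 in
  gup (lexpr H1 c1) (row_mx (crd c1 x1) (t *: p1)) =
    gup (lexpr H1 c1) (row_mx (crd c1 x1) p1) /\
  gup (lexpr H2 c2) (row_mx (crd c2 x2) (t *: p2)) =
    gup (lexpr H2 c2) (row_mx (crd c2 x2) p2).
Proof.
move=> bl p10 p20 t0 c1 c2; pose c : idx P := (c1, c2).
pose y : 'rV[R]_N := row_mx (crd c1 x1) (crd c2 x2); pose p : 'rV[R]_N := row_mx p1 p2.
have ph1 (s : R) : phase1 (row_mx y (s *: p)) = row_mx (crd c1 x1) (s *: p1).
  by rewrite /phase1 row_mxKl row_mxKr scale_row_mx !row_mxKl.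
have ph2 (s : R) : phase2 (row_mx y (s *: p)) = row_mx (crd c2 x2) (s *: p2).
  by rewrite /phase2 row_mxKl row_mxKr scale_row_mx !row_mxKr.
have d1 := atlas_cover s1 x1; have d2 := atlas_cover s2 x2.
have slit_ray (s : R) : 0 < s -> slit ((x1, x2), s *: p).
  by move=> s0; split; rewrite /= scale_row_mx ?row_mxKl ?row_mxKr scaler_eq0 (gt_eqF s0).
have iy : chart_img c setT y.
  by apply/prod_chart_imgP; rewrite row_mxKl row_mxKr; split; [exists x1|exists x2].
have i1 : chart_img c1 setT (crd c1 x1) by exists x1.
have i2 : chart_img c2 setT (crd c2 x2) by exists x2.
have OTr (s : R) : OT c (row_mx y (s *: p)).
  by apply/(cot_chart_imgP sP); rewrite row_mxKl; split.
have Sr (s : R) : 0 < s -> chart_img (A := cotangent P) c slit (row_mx y (s *: p)).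
  move=> s0; apply/slitP; split=> //; rewrite ?ph1 ?ph2.
    by apply/(cot_slitP s1); rewrite row_mxKl row_mxKr scaler_eq0 (gt_eqF s0).
  by apply/(cot_slitP s2); rewrite row_mxKl row_mxKr scaler_eq0 (gt_eqF s0).
have glowE : glow (lexpr H c) (row_mx y (t *: p)) = glow (lexpr H c) (row_mx y p).
  apply/matrixP => a b.
  apply: (constant_along_fibre_ray (g := fun w => glow (lexpr H c) w a b)) t0 => s s0.
    apply: (smooth_diff (glow_smooth (@slit_open c) (sHslit (c := c)) (@warped_gup_unit c) a b)).
    exact: Sr.
  exact: (liouville_derive0 hP slit_open sHslit warped_gup_unit warped_gup_sym hG hnabla bl
    a b (slit_ray s s0)).
have gupE : gup (lexpr H c) (row_mx y (t *: p)) = gup (lexpr H c) (row_mx y p).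
  exact: etrans (esym (invmxK _)) (etrans (congr1 (@invmx _ _) glowE) (invmxK _)).
have OTp : OT c (row_mx y p) by rewrite -(scale1r p).
have := etrans (esym (warped_gup (OTr t))) (etrans gupE (warped_gup OTp)).
rewrite ph1 ph2 -[in phase1 _](scale1r p) -[in phase2 _](scale1r p) ph1 ph2 !scale1r !row_mxKl.
move=> E; have [E1 _ _ E2] := eq_block_mx E; split.
  refine (etrans E1 _); reflexivity.
have fc0 : warping_expr c y != 0 := lt0r_neq0 (warping_expr_gt0 c y).
refine (etrans (scalerI fc0 E2) _); reflexivity.
Qed.

(** The covector on the other factor only has to be nonzero; this is where both factors
    need positive dimension. *)
Lemma warped_riemannian_of_bundle_like : (0 < n)%N -> (0 < m)%N ->
  bundle_like P H slit G nabla -> pseudo_riemannian A1 H1 /\ pseudo_riemannian A2 H2.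
Proof.
move=> n0 m0 bl.
have nz (k : nat) : (0 < k)%N -> (const_mx 1 : 'rV[R]_k) != 0.
  move=> k0; apply/eqP => /rowP/(_ (Ordinal k0)); rewrite !mxE => /eqP.
  by rewrite oner_eq0.
have [x1 _] := manifold_nonempty hM1; have [x2 _] := manifold_nonempty hM2.
split.
- apply: (pseudo_riemannian_of_origin s1 sH1) => x p c.
  have [->//|p0] := eqVneq p 0.
  pose O := chart_img (A := cotangent A1) c setT.
  have oO : open O := chart_img_open_total (cot_smooth_atlas s1) (c := c).
  have sO : smooth_on O (lexpr H1 c) := sH1 (c := c).
  apply: (gup_ray_origin oO sO).
    apply/(cot_chart_imgP s1); split=> //; rewrite row_mxKl; apply: chart_img_crd => //.
    exact: (atlas_cover s1).
  by move=> t t0; have [] := warped_gup_ray x x2 bl p0 (nz _ m0) t0.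
- apply: (pseudo_riemannian_of_origin s2 sH2) => x p c.
  have [->//|p0] := eqVneq p 0.
  pose O := chart_img (A := cotangent A2) c setT.
  have oO : open O := chart_img_open_total (cot_smooth_atlas s2) (c := c).
  have sO : smooth_on O (lexpr H2 c) := sH2 (c := c).
  apply: (gup_ray_origin oO sO).
    apply/(cot_chart_imgP s2); split=> //; rewrite row_mxKl; apply: chart_img_crd => //.
    exact: (atlas_cover s2).
  by move=> t t0; have [] := warped_gup_ray x1 x bl (nz _ n0) p0 t0.
Qed.

End Warped.

Theorem theorem5p1 (R : realType) (n m : nat) (hn : (0 < n)%N) (hm : (0 < m)%N)
  (M1 M2 : topologicalType) (A1 : atlas R n M1) (A2 : atlas R m M2)
  (hM1 : smooth_manifold A1) (hM2 : smooth_manifold A2)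
  (H1 : M1 * 'rV[R]_n -> R) (H2 : M2 * 'rV[R]_m -> R)
  (hH1 : hamiltonian_space A1 H1) (hH2 : hamiltonian_space A2 H2)
  (f : M1 -> R) (f_smooth : smooth_fun A1 setT f)
  (f_pos : forall x : M1, 0 < f x)
  (f_nonconst : exists x y : M1, f x <> f y)
  (G : (M1 * M2) * 'rV[R]_(n + m) -> 'rV[R]_((n + m) + (n + m)) ->
       'rV[R]_((n + m) + (n + m)) -> R)
  (hG : sasaki_metric (prod_atlas A1 A2) (warped_hamiltonian H1 H2 f)
          slit_cotangent G)
  (nabla : ((M1 * M2) * 'rV[R]_(n + m) -> 'rV[R]_((n + m) + (n + m))) ->
           ((M1 * M2) * 'rV[R]_(n + m) -> 'rV[R]_((n + m) + (n + m))) ->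
           (M1 * M2) * 'rV[R]_(n + m) -> 'rV[R]_((n + m) + (n + m)))
  (hnabla : levi_civita (cotangent (prod_atlas A1 A2)) slit_cotangent G nabla) :
  bundle_like (prod_atlas A1 A2) (warped_hamiltonian H1 H2 f) slit_cotangent
    G nabla
  <-> (pseudo_riemannian A1 H1 /\ pseudo_riemannian A2 H2).
Proof.
split; last first.
  move=> [pr1 pr2].
  exact: (warped_bundle_like_of_riemannian hM1 hM2 hH1 hH2 f_smooth f_pos hG hnabla pr1 pr2).
exact: (warped_riemannian_of_bundle_like hM1 hM2 hH1 hH2 f_smooth f_pos hG hnabla hn hm).
Qed.
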